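(* Let $q\ge 1$ and let $\lambda$ be a primitive $q$th root of unity. Let $g(z)=\lambda z+O(z^2)$ be holomorphic near $0$ and suppose $f:=g^{\circ q}$ has the form $f(z)=z+z^{q+1}+bz^{2q+1}+O(z^{2q+2})$ for some $b\in\mathbb C$. Fix $0<r_0<1$ such that $f$ is univalent in a neighborhood of $\overline{\mathbb D}(0,r_0)$, $0$ is the only fixed point of $f$ in $\overline{\mathbb D}(0,r_0)$, and $\operatorname{Re}(f')>0$ on $\overline{\mathbb D}(0,r_0)$. Let $g_n(z)=\lambda_n z+O(z^2)$ be holomorphic maps with $|\lambda_n|\neq 1$ such that $f_n:=g_n^{\circ q}$ is holomorphic in a neighborhood of $\overline{\mathbb D}(0,r_0)$ and $f_n\to f$ uniformly on $\overline{\mathbb D}(0,r_0)$. Let $\omega_n$ be the Buff form of $f_n$ and $\phi_n$ its (multi-valued) rectifying coordinate. Then for every $0<\epsilon<1$ there is $0<r<r_0$ such that for all sufficiently large $n$ the following holds. If $z\in\mathbb D(0,r)$ is not fixed by $f_n$, the curve $t\mapsto z_{n,t}=(1-t)z+tf_n(z)$ parametrizing the segment $[z,f_n(z)]$ lifts under $\phi_n$ to a curve $t\mapsto Z_{n,t}$ satisfying $$|Z_{n,t}-(Z_{n,0}+t)|<\epsilon t\qquad(0<t\le 1).$$ Similarly, the curve $t\mapsto \hat z_{n,t}=(1-t)z+tf_n^{-1}(z)$ parametrizing $[z,f_n^{-1}(z)]$ lifts under $\phi_n$ to a curve $t\mapsto \hat Z_{n,t}$ satisfying $$|\hat Z_{n,t}-(\hat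 Z_{n,0}-t)|<\epsilon t\qquad(0<t\le 1).$$
   Context: $\operatorname{Log}$ denotes the principal branch of the logarithm on $\mathbb C\setminus\,]-\infty,0]$. For a holomorphic map $h$ on a domain, its Buff form is the meromorphic $1$-form $\omega_h=\frac{h'(z)-1}{(h(z)-z)\operatorname{Log} h'(z)}\,dz$ (where $h'(z)=1$ the factor $(h'-1)/\operatorname{Log}h'$ is interpreted as $1$); it is non-vanishing with poles exactly at fixed points of $h$. The rectifying coordinate $\phi_h(z)=\int_{z_0}^z\omega_h$ is the multi-valued primitive of $\omega_h$ on the complement of the fixed points. A curve $t\mapsto Z_t$ is a lift under $\phi_n$ of a curve $t\mapsto z_t$ avoiding the poles of $\omega_n$ if $Z_t$ is obtained by analytic continuation of a branch of $\phi_n$ along $z_t$, i.e. $Z_t=Z_0+\int_{z_0}^{z_t}\omega_n$ along the curve. For large $n$, $f_n$ is univalent near $\overline{\mathbb D}(0,r_0)$ and $f_n^{-1}$ denotes its inverse near $0$. *)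

(* Defs.v *)
From Stdlib Require Import Reals.
From Coquelicot Require Import Coquelicot.

Open Scope R_scope.

Definition holo_at (h : C -> C) (z : C) : Prop :=
  @ex_derive C_AbsRing C_NormedModule h z.

Definition disk (r : R) (z : C) : Prop := Cmod z < r.

Definition holo_on (h : C -> C) (U : C -> Prop) : Prop :=
  forall z, U z -> holo_at h z.

Definition inj_on (h : C -> C) (U : C -> Prop) : Prop :=
  forall z w, U z -> U w -> h z = h w -> z = w.

Definition iterate (q : nat) (g : C -> C) : C -> C := fun z => Nat.iter q g z.

Definition primitive_root (q : nat) (l : C) : Prop :=
  Cpow l q = RtoC 1 /\ forall k : nat, (0 < k < q)%nat -> Cpow l k <> RtoC 1.

Definition on_cut (w : C) : Prop := Im w = 0 /\ Re w <= 0.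

(* principal logarithm on C \ ]-oo,0]:  ln|w| + i Arg w,
   with Arg w = 2 atan (Im w / (|w| + Re w)) in ]-pi,pi[ *)
Definition CLog (w : C) : C :=
  (ln (Cmod w), 2 * atan (Im w / (Cmod w + Re w))).

(* coefficient of the Buff form  omega_h = buff_coef h z dz *)
Definition buff_factor (h : C -> C) (z : C) : C :=
  let d := C_derive h z in
  if Ceq_dec d (RtoC 1) then RtoC 1 else Cdiv (Cminus d (RtoC 1)) (CLog d).

Definition buff_coef (h : C -> C) (z : C) : C :=
  Cdiv (buff_factor h z) (Cminus (h z) z).

Definition seg (z w : C) (t : R) : C :=
  Cplus (Cmult (RtoC (1 - t)) z) (Cmult (RtoC t) w).

(* Z is a lift under the rectifying coordinate phi_h of the segment
   t |-> seg z w t: the segment stays in the domain of omega_h and avoids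
   its poles (fixed points of h), and
   Z t = Z 0 + int_{seg z w [0,t]} omega_h  for all t in [0,1]. *)
Definition lift_segment (h : C -> C) (z w : C) (Z : R -> C) : Prop :=
  (forall t, 0 <= t <= 1 ->
     holo_at h (seg z w t) /\ ~ on_cut (C_derive h (seg z w t))
     /\ h (seg z w t) <> seg z w t) /\
  (forall t, 0 <= t <= 1 ->
     @is_RInt C_R_NormedModule
       (fun s => Cmult (buff_coef h (seg z w s)) (Cminus w z)) 0 t
       (Cminus (Z t) (Z 0))).

(* Main.v *)
Require Import Defs.
From Stdlib Require Import Reals Lra Lia ClassicalEpsilon.
From Coquelicot Require Import Coquelicot.

Open Scope R_scope.

(** Write [u := f_n - id].  Near [0] one has [|u| <= |f_n - f| + |f - id| = o(1) + O(|z|^2)],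
    so Cauchy's estimate makes [u'] uniformly small on a small disk.  Hence [u] is
    almost constant, relative to its size, along the segments [[z, f_n z]] and
    [[z, f_n^-1 z]], while [f_n'] is close to [1] and the factor
    [(f_n' - 1) / Log f_n'] is close to [1]: the integrand of the lift is uniformly
    close to [1] (resp. [-1]).  Any preimage of a small [z] in the disk of radius [r0]
    is itself small because [|f|] is bounded below on annuli, and one exists because
    [u] is a contraction.

    Complex differentiability is assumed without continuity of the derivative, so
    Cauchy's estimate goes through Goursat's bisection argument; applied to
    differences [h (z + v) - h z] it then also gives continuity of [h']. *)

(** The segments may come arbitrarily close to poles of the Buff form, so no lower bound on [|u|] is
    uniform in [z], and every estimate has to be relative to the displacement itself. This closes up
    because the segment from [z] to [f_n z] has length exactly [|u z|]: a Lipschitz constant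
    [eps / 52] for [u] bounds its variation there by [eps / 52] times [|u z|]. For the backward
    segment the same holds with the preimage [w] as reference point, since [u w = z - w]. The
    choices do not become circular because a bound of order [r1 ^ 2] for [u] on the disk of radius
    [2 * r1] gives a bound of order [r1] for [u'] on the disk of radius [r1]. Thus [r1] depends only
    on [f] and [eps], and [n] is then taken so large that [f_n - f] is below [r1 ^ 2]. *)

(** * Integrals of complex-valued functions of a real variable *)

Lemma continuous_RC_eps (f : R -> C) (x : R) :
  (forall e, 0 < e -> exists d, 0 < d /\
     forall y, Rabs (y - x) < d -> Cmod (Cminus (f y) (f x)) < e) ->
  continuous (U := C_UniformSpace) f x.
Proof.
  intros H P [e He].
  destruct (H e (cond_pos e)) as [d [Hd Hf]].
  exists (mkposreal d Hd); intros y Hy.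
  apply He, C_NormedModule_mixin_compat1, Hf, Hy.
Qed.

Lemma ex_CRInt_continuous (f : R -> C) (a b : R) : a <= b ->
  (forall x, a <= x <= b -> continuous (U := C_UniformSpace) f x) ->
  ex_RInt (V := C_R_NormedModule) f a b.
Proof.
  intros Hab H.
  apply (ex_RInt_continuous (V := C_R_CompleteNormedModule)).
  intros z Hz; rewrite Rmin_left, Rmax_right in Hz by lra.
  apply H, Hz.
Qed.

Lemma Cmod_CRInt_le (f : R -> C) (a b M : R) (l : C) : a <= b ->
  (forall x, a <= x <= b -> Cmod (f x) <= M) ->
  is_RInt (V := C_R_NormedModule) f a b l -> Cmod l <= (b - a) * M.
Proof.
  intros Hab H Hl.
  rewrite Cmod_norm.
  apply (norm_RInt_le_const (V := C_R_NormedModule) f a b l M Hab); trivial.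
  intros x Hx; rewrite <- Cmod_norm; auto.
Qed.

(** These explicit values make the contour integral of an affine function vanish by pure algebra,
    the base case of Goursat's argument. *)
Lemma is_CRInt_affine (u v : C) (a b : R) :
  is_RInt (V := C_R_NormedModule) (fun x => Cplus u (Cmult (RtoC x) v)) a b
    (Cplus (Cmult (RtoC (b - a)) u) (Cmult (RtoC ((b * b - a * a) / 2)) v)).
Proof.
  assert (Haff : forall p q : R,
    is_RInt (fun x => p + x * q) a b ((b - a) * p + (b * b - a * a) / 2 * q)).
  { intros p q.
    replace ((b - a) * p + (b * b - a * a) / 2 * q)
      with (minus (b * p + b * b / 2 * q) (a * p + a * a / 2 * q))
      by (unfold minus, plus, opp; simpl; field).
    apply (is_RInt_derive (fun x => x * p + x * x / 2 * q)).
    - intros x _; auto_derive; trivial; field.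
    - intros x _.
      apply (continuous_plus (fun _ => p) (fun x => x * q)).
      + apply continuous_const.
      + apply (continuous_mult (fun x => x) (fun _ => q)).
        apply continuous_id. apply continuous_const. }
  destruct u as [u1 u2], v as [v1 v2].
  replace (Cplus (Cmult (RtoC (b - a)) (u1, u2))
            (Cmult (RtoC ((b * b - a * a) / 2)) (v1, v2)))
    with ((b - a) * u1 + (b * b - a * a) / 2 * v1,
          (b - a) * u2 + (b * b - a * a) / 2 * v2)
    by (unfold Cplus, Cmult, RtoC; simpl; f_equal; ring).
  apply is_RInt_fct_extend_pair.
  - apply is_RInt_ext with (2 := Haff u1 v1).
    intros x _; simpl; ring.
  - apply is_RInt_ext with (2 := Haff u2 v2).
    intros x _; simpl; ring.
Qed.

(** * Complex differentiability in epsilon-delta form *)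

(** The difference quotient is multiplied out and the inequality is not strict, so that [w = z]
    needs no exception. *)
Definition cdiff (h : C -> C) (z l : C) : Prop :=
  forall e, 0 < e -> exists d, 0 < d /\ forall w, Cmod (Cminus w z) < d ->
    Cmod (Cminus (Cminus (h w) (h z)) (Cmult l (Cminus w z)))
      <= e * Cmod (Cminus w z).

Lemma cdiff_is_derive (h : C -> C) (z l : C) :
  cdiff h z l <-> @is_derive C_AbsRing C_NormedModule h z l.
Proof.
  split.
  - intros H; split; [apply is_linear_scal_l|].
    intros x Hx e.
    assert (E0 : z = x) by
      exact (is_filter_lim_locally_unique
               (V := AbsRing_NormedModule C_AbsRing) z x Hx).
    subst x.
    destruct (H e (cond_pos e)) as [d [Hd Hw]].
    exists (mkposreal d Hd); intros w Hdw.
    specialize (Hw w Hdw); rewrite (Cmult_comm l) in Hw; exact Hw.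
  - intros [_ H] e He.
    destruct (H z (fun P HP => HP) (mkposreal e He)) as [d Hd].
    exists d; split; [apply cond_pos|].
    intros w Hw; specialize (Hd w Hw).
    rewrite (Cmult_comm l); exact Hd.
Qed.

Lemma cdiff_continuous (h : C -> C) (z l : C) : cdiff h z l ->
  forall e, 0 < e -> exists d, 0 < d /\ forall w, Cmod (Cminus w z) < d ->
    Cmod (Cminus (h w) (h z)) < e.
Proof.
  intros H e He.
  destruct (H 1 Rlt_0_1) as [d [Hd Hw]].
  assert (Hl := Cmod_ge_0 l).
  assert (He' : 0 < e / (Cmod l + 2)) by (apply Rdiv_lt_0_compat; lra).
  exists (Rmin d (e / (Cmod l + 2))); split; [apply Rmin_pos; lra|].
  intros w Hwz.
  assert (H1 : Cmod (Cminus w z) < d) by (eapply Rlt_le_trans; [exact Hwz|apply Rmin_l]).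
  assert (H2 : Cmod (Cminus w z) < e / (Cmod l + 2)) by (eapply Rlt_le_trans; [exact Hwz|apply Rmin_r]).
  specialize (Hw w H1).
  replace (Cminus (h w) (h z)) with
    (Cplus (Cminus (Cminus (h w) (h z)) (Cmult l (Cminus w z))) (Cmult l (Cminus w z))) by ring.
  eapply Rle_lt_trans; [apply Cmod_triangle|].
  rewrite Cmod_mult.
  assert (H3 : Cmod (Cminus w z) * (Cmod l + 2) < e).
  { apply (Rmult_lt_reg_r (/ (Cmod l + 2))); [apply Rinv_0_lt_compat; lra|].
    rewrite Rmult_assoc, Rinv_r by lra. rewrite Rmult_1_r. exact H2. }
  assert (H4 := Cmod_ge_0 (Cminus w z)).
  nra.
Qed.

(** * Goursat's theorem on rectangles *)

Lemma nested_intervals (a b : nat -> R) :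
  (forall n, a n <= a (S n)) -> (forall n, b (S n) <= b n) ->
  (forall n, a n <= b n) -> exists x, forall n, a n <= x <= b n.
Proof.
  intros Ha Hb Hab.
  assert (Ha' : forall k n, a n <= a (n + k)%nat).
  { induction k as [|k IH]; intros n; [rewrite Nat.add_0_r; lra|].
    rewrite Nat.add_succ_r; specialize (IH n); specialize (Ha (n + k)%nat); lra. }
  assert (Hb' : forall k n, b (n + k)%nat <= b n).
  { induction k as [|k IH]; intros n; [rewrite Nat.add_0_r; lra|].
    rewrite Nat.add_succ_r; specialize (IH n); specialize (Hb (n + k)%nat); lra. }
  assert (Hle : forall m n, a m <= b n).
  { intros m n; specialize (Ha' n m); specialize (Hb' m n); specialize (Hab (m + n)%nat).
    rewrite (Nat.add_comm n m) in Hb'; lra. }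
  destruct (completeness (fun x => exists n, x = a n)) as [x [Hub Hlub]].
  - exists (b O); intros x [n ->]; apply Hle.
  - exists (a O), O; reflexivity.
  - exists x; intros n; split.
    + apply Hub; exists n; reflexivity.
    + apply Hlub; intros y [m ->]; apply Hle.
Qed.

Definition int_h (H : C -> C) (a b y : R) : C :=
  RInt (V := C_R_CompleteNormedModule) (fun x => H (x, y)) a b.

Definition int_v (H : C -> C) (x c d : R) : C :=
  RInt (V := C_R_CompleteNormedModule) (fun y => H (x, y)) c d.

(** Counterclockwise integral of [H dz]: bottom and right sides minus top and left sides, each run
    in the increasing direction, with [dz = i dy] on vertical sides. *)
Definition contour (H : C -> C) (a b c d : R) : C :=
  Cminus (Cplus (int_h H a b c) (Cmult Ci (int_v H b c d)))
         (Cplus (int_h H a b d) (Cmult Ci (int_v H a c d))).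

Definition rect (a b c d : R) (z : C) : Prop :=
  a <= fst z <= b /\ c <= snd z <= d.

Section Rectangles.

Variables (H : C -> C) (A B C0 D : R).
Hypothesis Hdiff : forall z, rect A B C0 D z -> exists l, cdiff H z l.

Lemma continuous_row x y : rect A B C0 D (x, y) ->
  continuous (U := C_UniformSpace) (fun x => H (x, y)) x.
Proof.
  intros Hr; destruct (Hdiff _ Hr) as [l Hl].
  apply continuous_RC_eps; intros e He.
  destruct (cdiff_continuous _ _ _ Hl e He) as [d [Hd Hw]].
  exists d; split; trivial; intros x' Hx'; apply Hw.
  assert (E : Cminus (x', y) (x, y) = RtoC (x' - x))
    by (unfold Cminus, Cplus, Copp, RtoC; simpl; f_equal; ring).
  rewrite <- Cmod_R, <- E in Hx'; exact Hx'.
Qed.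

Lemma continuous_column x y : rect A B C0 D (x, y) ->
  continuous (U := C_UniformSpace) (fun y => H (x, y)) y.
Proof.
  intros Hr; destruct (Hdiff _ Hr) as [l Hl].
  apply continuous_RC_eps; intros e He.
  destruct (cdiff_continuous _ _ _ Hl e He) as [d [Hd Hw]].
  exists d; split; trivial; intros y' Hy'; apply Hw.
  assert (E : Cminus (x, y') (x, y) = Cmult Ci (RtoC (y' - y)))
    by (unfold Cminus, Cplus, Copp, RtoC, Cmult, Ci; simpl; f_equal; ring).
  rewrite <- Cmod_R, <- (Rmult_1_l (Cmod _)), <- Cmod_Ci, <- Cmod_mult, <- E in Hy'.
  exact Hy'.
Qed.

Lemma ex_int_h a b y : A <= a -> a <= b -> b <= B -> C0 <= y <= D ->
  ex_RInt (V := C_R_NormedModule) (fun x => H (x, y)) a b.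
Proof.
  intros; apply ex_CRInt_continuous; trivial.
  intros x Hx; apply continuous_row; split; simpl; lra.
Qed.

Lemma ex_int_v x c d : C0 <= c -> c <= d -> d <= D -> A <= x <= B ->
  ex_RInt (V := C_R_NormedModule) (fun y => H (x, y)) c d.
Proof.
  intros; apply ex_CRInt_continuous; trivial.
  intros y Hy; apply continuous_column; split; simpl; lra.
Qed.

Lemma contour_split_h a m b c d :
  A <= a -> a <= m -> m <= b -> b <= B -> C0 <= c -> c <= d -> d <= D ->
  contour H a b c d = Cplus (contour H a m c d) (contour H m b c d).
Proof.
  intros.
  assert (E : forall y, C0 <= y <= D -> int_h H a b y = Cplus (int_h H a m y) (int_h H m b y)).
  { intros y Hy; unfold int_h; symmetry.
    apply (RInt_Chasles (V := C_R_CompleteNormedModule)); apply ex_int_h; lra. }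
  unfold contour; rewrite !E by lra; ring.
Qed.

Lemma contour_split_v a b c m d :
  A <= a -> a <= b -> b <= B -> C0 <= c -> c <= m -> m <= d -> d <= D ->
  contour H a b c d = Cplus (contour H a b c m) (contour H a b m d).
Proof.
  intros.
  assert (E : forall x, A <= x <= B -> int_v H x c d = Cplus (int_v H x c m) (int_v H x m d)).
  { intros y Hy; unfold int_v; symmetry.
    apply (RInt_Chasles (V := C_R_CompleteNormedModule)); apply ex_int_v; lra. }
  unfold contour; rewrite !E by lra; ring.
Qed.

(** An affine function has zero contour integral: its side integrals are [Eh] and [Ev], and they
    cancel by [ring]. Only the deviation from it remains, at most [M] times the perimeter. *)
Lemma contour_near_affine a b c d (u v : C) (M : R) :
  A <= a -> a <= b -> b <= B -> C0 <= c -> c <= d -> d <= D ->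
  (forall z, rect a b c d z -> Cmod (Cminus (H z) (Cplus u (Cmult z v))) <= M) ->
  Cmod (contour H a b c d) <= 2 * ((b - a) + (d - c)) * M.
Proof.
  intros HA Hab HB HC Hcd HD HM.
  set (Eh := fun y : R => Cplus (Cmult (RtoC (b - a)) (Cplus u (Cmult (Cmult Ci (RtoC y)) v)))
               (Cmult (RtoC ((b * b - a * a) / 2)) v)).
  set (Ev := fun x : R => Cplus (Cmult (RtoC (d - c)) (Cplus u (Cmult (RtoC x) v)))
               (Cmult (RtoC ((d * d - c * c) / 2)) (Cmult Ci v))).
  assert (Bh : forall y, c <= y <= d -> Cmod (Cminus (int_h H a b y) (Eh y)) <= (b - a) * M).
  { intros y Hy.
    apply (Cmod_CRInt_le (fun x => Cminus (H (x, y))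
       (Cplus (Cplus u (Cmult (Cmult Ci (RtoC y)) v)) (Cmult (RtoC x) v)))); trivial.
    - intros x Hx.
      replace (Cplus (Cplus u (Cmult (Cmult Ci y) v)) (Cmult x v))
        with (Cplus u (Cmult (x, y) v)).
      + apply HM; split; simpl; lra.
      + replace (x, y) with (Cplus (RtoC x) (Cmult Ci (RtoC y)));
          [ring | unfold Cplus, Cmult, Ci, RtoC; simpl; f_equal; ring].
    - apply (is_RInt_minus (V := C_R_NormedModule)).
      + apply (RInt_correct (V := C_R_CompleteNormedModule)), ex_int_h; lra.
      + apply is_CRInt_affine. }
  assert (Bv : forall x, a <= x <= b -> Cmod (Cminus (int_v H x c d) (Ev x)) <= (d - c) * M).
  { intros x Hx.
    apply (Cmod_CRInt_le (fun y => Cminus (H (x, y))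
       (Cplus (Cplus u (Cmult (RtoC x) v)) (Cmult (RtoC y) (Cmult Ci v))))); trivial.
    - intros y Hy.
      replace (Cplus (Cplus u (Cmult x v)) (Cmult y (Cmult Ci v)))
        with (Cplus u (Cmult (x, y) v)).
      + apply HM; split; simpl; lra.
      + replace (x, y) with (Cplus (RtoC x) (Cmult Ci (RtoC y)));
          [ring | unfold Cplus, Cmult, Ci, RtoC; simpl; f_equal; ring].
    - apply (is_RInt_minus (V := C_R_NormedModule)).
      + apply (RInt_correct (V := C_R_CompleteNormedModule)), ex_int_v; lra.
      + apply is_CRInt_affine. }
  replace (contour H a b c d) with
    (Cplus (Cplus (Cminus (int_h H a b c) (Eh c)) (Cmult Ci (Cminus (int_v H b c d) (Ev b))))
      (Copp (Cplus (Cminus (int_h H a b d) (Eh d)) (Cmult Ci (Cminus (int_v H a c d) (Ev a)))))).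
  - eapply Rle_trans; [apply Cmod_triangle|].
    rewrite Cmod_opp.
    assert (T1 := Cmod_triangle (Cminus (int_h H a b c) (Eh c)) (Cmult Ci (Cminus (int_v H b c d) (Ev b)))).
    assert (T2 := Cmod_triangle (Cminus (int_h H a b d) (Eh d)) (Cmult Ci (Cminus (int_v H a c d) (Ev a)))).
    rewrite Cmod_mult, Cmod_Ci in T1, T2.
    assert (B1 := Bh c); assert (B2 := Bh d); assert (B3 := Bv a); assert (B4 := Bv b).
    lra.
  - unfold contour, Eh, Ev.
    rewrite !RtoC_minus. ring.
Qed.

(** The contour integrals of the four quarters add up to the whole, so one of them carries at least
    a quarter of the modulus. Describing that quarter by offsets [i] and [j] lets the bisection
    remember a lower left corner only. *)
Lemma contour_half a b c d :
  A <= a -> a <= b -> b <= B -> C0 <= c -> c <= d -> d <= D ->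
  exists i j : R, (i = 0 \/ i = (b - a) / 2) /\ (j = 0 \/ j = (d - c) / 2) /\
    Cmod (contour H a b c d)
      <= 4 * Cmod (contour H (a + i) (a + i + (b - a) / 2) (c + j) (c + j + (d - c) / 2)).
Proof.
  intros.
  set (p := (b - a) / 2); set (q := (d - c) / 2).
  assert (E : contour H a b c d =
    Cplus (Cplus (contour H (a + 0) (a + 0 + p) (c + 0) (c + 0 + q))
                 (contour H (a + 0) (a + 0 + p) (c + q) (c + q + q)))
          (Cplus (contour H (a + p) (a + p + p) (c + 0) (c + 0 + q))
                 (contour H (a + p) (a + p + p) (c + q) (c + q + q)))).
  { rewrite !Rplus_0_r.
    replace (a + p + p) with b by (unfold p; field).
    replace (c + q + q) with d by (unfold q; field).
    rewrite (contour_split_h a (a + p) b c d) by (unfold p; lra).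
    rewrite (contour_split_v a (a + p) c (c + q) d) by (unfold p, q; lra).
    rewrite (contour_split_v (a + p) b c (c + q) d) by (unfold p, q; lra).
    ring. }
  set (k1 := contour H (a + 0) (a + 0 + p) (c + 0) (c + 0 + q)) in E.
  set (k2 := contour H (a + 0) (a + 0 + p) (c + q) (c + q + q)) in E.
  set (k3 := contour H (a + p) (a + p + p) (c + 0) (c + 0 + q)) in E.
  set (k4 := contour H (a + p) (a + p + p) (c + q) (c + q + q)) in E.
  assert (T : Cmod (contour H a b c d) <= Cmod k1 + Cmod k2 + (Cmod k3 + Cmod k4)).
  { rewrite E; eapply Rle_trans; [apply Cmod_triangle|].
    apply Rplus_le_compat; apply Cmod_triangle. }
  destruct (Rle_dec (Cmod (contour H a b c d)) (4 * Cmod k1)); [exists 0, 0; auto|].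
  destruct (Rle_dec (Cmod (contour H a b c d)) (4 * Cmod k2)); [exists 0, q; auto|].
  destruct (Rle_dec (Cmod (contour H a b c d)) (4 * Cmod k3)); [exists p, 0; auto|].
  destruct (Rle_dec (Cmod (contour H a b c d)) (4 * Cmod k4)); [exists p, q; auto|].
  exfalso; lra.
Qed.

End Rectangles.

Lemma Cmod_le_abs (z : C) : Cmod z <= Rabs (fst z) + Rabs (snd z).
Proof.
  replace z with (Cplus (RtoC (fst z)) (Cmult Ci (RtoC (snd z)))) at 1
    by (destruct z; unfold Cplus, Cmult, Ci, RtoC; simpl; f_equal; ring).
  eapply Rle_trans; [apply Cmod_triangle|].
  rewrite Cmod_mult, Cmod_Ci, !Cmod_R; lra.
Qed.

(** Everything scales like [s N * s N]: each bisection costs at most a factor 4 in the contour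
    integral, while perimeter and diameter are both halved. This common factor cancels and leaves a
    bound proportional to the linearization error alone. *)
Theorem goursat (H : C -> C) (A B C0 D : R) : A <= B -> C0 <= D ->
  (forall z, rect A B C0 D z -> exists l, cdiff H z l) ->
  contour H A B C0 D = RtoC 0.
Proof.
  intros HAB HCD Hdiff.
  set (W := B - A); set (V := D - C0); set (s := fun k : nat => / 2 ^ k).
  assert (Hs : forall k, 0 < s k) by (intros; apply Rinv_0_lt_compat, pow_lt; lra).
  assert (HsS : forall k, s (S k) = s k / 2)
    by (intros k; unfold s; simpl; field; apply pow_nonzero; lra).
  assert (HW : 0 <= W) by (unfold W; lra).
  assert (HV : 0 <= V) by (unfold V; lra).
  set (Rk := fun (k : nat) (p : C) =>
    contour H (fst p) (fst p + W * s k) (snd p) (snd p + V * s k)).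
  set (valid := fun (k : nat) (p : C) =>
    (A <= fst p /\ fst p + W * s k <= B) /\ (C0 <= snd p /\ snd p + V * s k <= D)).
  set (Q := fun (k : nat) (p p' : C) =>
    (fst p' = fst p \/ fst p' = fst p + W * s (S k)) /\
    (snd p' = snd p \/ snd p' = snd p + V * s (S k)) /\
    Cmod (Rk k p) <= 4 * Cmod (Rk (S k) p')).
  assert (Hstep : forall k p, valid k p -> exists p', Q k p p').
  { intros k [x y] [[V1 V2] [V3 V4]]; simpl in *.
    assert (P1 := Rmult_le_pos _ _ HW (Rlt_le _ _ (Hs k))).
    assert (P2 := Rmult_le_pos _ _ HV (Rlt_le _ _ (Hs k))).
    destruct (contour_half H A B C0 D Hdiff x (x + W * s k) y (y + V * s k))
      as [i [j [Hi [Hj Hc]]]]; try lra.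
    replace ((x + W * s k - x) / 2) with (W * s (S k)) in * by (rewrite HsS; field).
    replace ((y + V * s k - y) / 2) with (V * s (S k)) in * by (rewrite HsS; field).
    exists (x + i, y + j); split; [|split]; simpl.
    - destruct Hi; [left|right]; lra.
    - destruct Hj; [left|right]; lra.
    - exact Hc. }
  (* The recursion is total whether or not a suitable quarter exists. [Hv] establishes by induction
     that each corner is valid, and only then does [Hstep] make the choice meaningful. *)
  set (p := fix p k := match k with
    | O => (A, C0) | S k => epsilon (inhabits (RtoC 0)) (Q k (p k)) end).
  assert (Hv : forall k, valid k (p k)).
  { induction k as [|k IH].
    - unfold valid, p, s, W, V; simpl; lra.
    - assert (Hq := epsilon_spec (inhabits (RtoC 0)) _ (Hstep k _ IH)).
      change (epsilon (inhabits (RtoC 0)) (Q k (p k))) with (p (S k)) in Hq.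
      destruct Hq as [Hx [Hy _]], IH as [H1 H2]; unfold valid.
      rewrite HsS in *.
      assert (P1 := Rmult_le_pos _ _ HW (Rlt_le _ _ (Hs k))).
      assert (P2 := Rmult_le_pos _ _ HV (Rlt_le _ _ (Hs k))).
      split; lra. }
  assert (Hq : forall k, Q k (p k) (p (S k))).
  { intros k; exact (epsilon_spec (inhabits (RtoC 0)) _ (Hstep k _ (Hv k))). }
  assert (Hgrow : forall k, Cmod (contour H A B C0 D) * s k * s k <= Cmod (Rk k (p k))).
  { induction k as [|k IH].
    - unfold Rk, p, s, W, V; simpl.
      replace (A + (B - A) * / 1) with B by field.
      replace (C0 + (D - C0) * / 1) with D by field. lra.
    - destruct (Hq k) as [_ [_ Hc]]; rewrite HsS; lra. }
  assert (Hpos : forall k, 0 <= W * s k /\ 0 <= V * s k).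
  { intros k; split; apply Rmult_le_pos; trivial; left; apply Hs. }
  destruct (nested_intervals (fun k => fst (p k)) (fun k => fst (p k) + W * s k))
    as [xs Hxs].
  { intros k; destruct (Hq k) as [Hx _]; specialize (Hpos (S k)); lra. }
  { intros k; destruct (Hq k) as [Hx _]; specialize (Hpos k); rewrite HsS in *; lra. }
  { intros k; specialize (Hpos k); lra. }
  destruct (nested_intervals (fun k => snd (p k)) (fun k => snd (p k) + V * s k))
    as [ys Hys].
  { intros k; destruct (Hq k) as [_ [Hx _]]; specialize (Hpos (S k)); lra. }
  { intros k; destruct (Hq k) as [_ [Hx _]]; specialize (Hpos k); rewrite HsS in *; lra. }
  { intros k; specialize (Hpos k); lra. }
  destruct (Hdiff (xs, ys)) as [l Hl].
  { specialize (Hxs O); specialize (Hys O); unfold p, s, W, V in Hxs, Hys.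
    simpl in Hxs, Hys; split; simpl; lra. }
  apply Cmod_eq_0, Rle_antisym; [|apply Cmod_ge_0].
  apply le_epsilon; intros e He; rewrite Rplus_0_l.
  set (T := W + V).
  assert (HT : 0 <= T) by (unfold T; lra).
  (* The product of perimeter [2 * T * s N] and diameter bound [T * s N] produces [2 * T * T]; the
     added 1 covers a rectangle degenerated to a point. *)
  assert (He' : 0 < e / (2 * T * T + 1)) by (apply Rdiv_lt_0_compat; nra).
  destruct (Hl _ He') as [d [Hd Hdl]].
  destruct (archimed_cor1 (d / (T + 1))) as [N [HN HN0]];
    [apply Rdiv_lt_0_compat; lra|].
  assert (HsN : s N <= / INR N).
  { unfold s; apply Rinv_le_contravar; [apply lt_0_INR; lia|].
    clear; induction N as [|N IH]; [simpl; lra|].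
    rewrite S_INR; change (2 ^ S N) with (2 * 2 ^ N).
    assert (1 <= 2 ^ N) by (apply pow_R1_Rle; lra); lra. }
  assert (HTd : T * s N < d).
  { assert (H1 : s N < d / (T + 1)) by lra.
    apply (Rmult_lt_compat_r (T + 1)) in H1; [|lra].
    unfold Rdiv in H1; rewrite Rmult_assoc, Rinv_l, Rmult_1_r in H1 by lra.
    specialize (Hs N); nra. }
  specialize (Hxs N); specialize (Hys N); destruct (Hpos N) as [Hp1 Hp2].
  destruct (Hv N) as [HV1 HV2].
  assert (Hb : Cmod (Rk N (p N)) <= 2 * ((fst (p N) + W * s N - fst (p N)) +
     (snd (p N) + V * s N - snd (p N))) * (e / (2 * T * T + 1) * (T * s N))).
  (* The affine comparison function is the first-order expansion of [H] at the point common to all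
     nested rectangles. *)
  { apply (contour_near_affine H A B C0 D Hdiff _ _ _ _
      (Cminus (H (xs, ys)) (Cmult l (xs, ys))) l); try lra.
    intros z [Hz1 Hz2].
    assert (Hz : Cmod (Cminus z (xs, ys)) <= T * s N).
    { eapply Rle_trans; [apply Cmod_le_abs|].
      unfold T; rewrite Rmult_plus_distr_r.
      apply Rplus_le_compat; apply Rabs_le; simpl; lra. }
    replace (Cminus (H z) (Cplus (Cminus (H (xs, ys)) (Cmult l (xs, ys))) (Cmult z l)))
      with (Cminus (Cminus (H z) (H (xs, ys))) (Cmult l (Cminus z (xs, ys)))) by ring.
    eapply Rle_trans; [apply Hdl; lra|].
    apply Rmult_le_compat_l; lra. }
  specialize (Hgrow N); specialize (Hs N).
  set (m := Cmod (contour H A B C0 D)) in *.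
  set (e1 := e / (2 * T * T + 1)) in *.
  assert (Hm : m * (s N * s N) <= (2 * T * T * e1) * (s N * s N)) by (unfold T in *; lra).
  apply Rmult_le_reg_r in Hm; [|apply Rmult_lt_0_compat; lra].
  assert (Ee : e1 * (2 * T * T + 1) = e) by (unfold e1; field; nra).
  nra.
Qed.

(** * Calculus rules for complex derivatives *)

(* Coquelicot's product rule is stated for the normed module [AbsRing_NormedModule C_AbsRing],
   which is not convertible to [C_NormedModule]. *)
Lemma cdiff_is_derive_abs (h : C -> C) (z l : C) :
  cdiff h z l <->
  @is_derive C_AbsRing (AbsRing_NormedModule C_AbsRing) h z l.
Proof.
  split.
  - intros H; split; [apply is_linear_scal_l|].
    intros x Hx e.
    assert (E0 : z = x) by
      exact (is_filter_lim_locally_unique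
               (V := AbsRing_NormedModule C_AbsRing) z x Hx).
    subst x.
    destruct (H e (cond_pos e)) as [d [Hd Hw]].
    exists (mkposreal d Hd); intros w Hdw.
    specialize (Hw w Hdw); rewrite (Cmult_comm l) in Hw; exact Hw.
  - intros [_ H] e He.
    destruct (H z (fun P HP => HP) (mkposreal e He)) as [d Hd].
    exists d; split; [apply cond_pos|].
    intros w Hw; specialize (Hd w Hw).
    rewrite (Cmult_comm l); exact Hd.
Qed.

Lemma cdiff_mult (f g : C -> C) (z df dg : C) :
  cdiff f z df -> cdiff g z dg ->
  cdiff (fun w => Cmult (f w) (g w)) z (Cplus (Cmult df (g z)) (Cmult (f z) dg)).
Proof.
  rewrite !cdiff_is_derive_abs; intros Hf Hg.
  apply (is_derive_mult (K := C_AbsRing)); trivial.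
  apply Cmult_comm.
Qed.

Lemma cdiff_comp (f g : C -> C) (z df dg : C) :
  cdiff f (g z) df -> cdiff g z dg ->
  cdiff (fun w => f (g w)) z (Cmult dg df).
Proof.
  rewrite !cdiff_is_derive_abs; intros Hf Hg.
  apply (is_derive_comp (K := C_AbsRing) (V := AbsRing_NormedModule C_AbsRing)); trivial.
Qed.

Lemma cdiff_ext_loc (f g : C -> C) (z l : C) (r : R) : 0 < r ->
  (forall w, Cmod (Cminus w z) < r -> f w = g w) -> cdiff f z l -> cdiff g z l.
Proof.
  intros Hr E Hf e He.
  destruct (Hf e He) as [d [Hd Hw]].
  exists (Rmin r d); split; [apply Rmin_pos; lra|].
  intros w Hwz.
  assert (H1 := Rmin_l r d); assert (H2 := Rmin_r r d).
  rewrite <- (E w), <- (E z); [apply Hw; lra| |lra].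
  replace (Cminus z z) with (RtoC 0) by ring; rewrite Cmod_0; lra.
Qed.

Lemma cdiff_minus (f g : C -> C) (z df dg : C) :
  cdiff f z df -> cdiff g z dg ->
  cdiff (fun w => Cminus (f w) (g w)) z (Cminus df dg).
Proof.
  rewrite !cdiff_is_derive; intros Hf Hg.
  apply (is_derive_minus (K := C_AbsRing) (V := C_NormedModule)); trivial.
Qed.

Lemma cdiff_const (c z : C) : cdiff (fun _ => c) z (RtoC 0).
Proof.
  intros e He; exists 1; split; [lra|]; intros w _.
  replace (Cminus (Cminus c c) (Cmult 0 (Cminus w z))) with (RtoC 0) by ring.
  rewrite Cmod_0; apply Rmult_le_pos; [lra|apply Cmod_ge_0].
Qed.

Lemma cdiff_affine (c k z : C) : cdiff (fun w => Cplus c (Cmult k w)) z k.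
Proof.
  intros e He; exists 1; split; [lra|]; intros w _.
  replace (Cminus _ _) with (RtoC 0) by ring.
  rewrite Cmod_0; apply Rmult_le_pos; [lra|apply Cmod_ge_0].
Qed.

(** * The complex exponential *)

Definition cexp (w : C) : C :=
  (exp (fst w) * cos (snd w), exp (fst w) * sin (snd w)).

Lemma cexp_plus (u v : C) : cexp (Cplus u v) = Cmult (cexp u) (cexp v).
Proof.
  unfold cexp, Cmult, Cplus; simpl.
  rewrite exp_plus, cos_plus, sin_plus; f_equal; ring.
Qed.

Lemma cexp_opp_mult (w : C) : Cmult (cexp w) (cexp (Copp w)) = RtoC 1.
Proof.
  rewrite <- cexp_plus; replace (Cplus w (Copp w)) with (RtoC 0) by ring.
  unfold cexp, RtoC; simpl; rewrite exp_0, cos_0, sin_0; f_equal; ring.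
Qed.

Lemma Cmod_cexp (w : C) : Cmod (cexp w) = exp (fst w).
Proof.
  unfold Cmod, cexp; simpl fst; simpl snd.
  replace ((exp (fst w) * cos (snd w)) ^ 2 + (exp (fst w) * sin (snd w)) ^ 2)
    with (exp (fst w) * exp (fst w) * (Rsqr (sin (snd w)) + Rsqr (cos (snd w))))
    by (unfold Rsqr; ring).
  rewrite sin2_cos2, Rmult_1_r; apply sqrt_square; left; apply exp_pos.
Qed.

Lemma is_derive_eps (f : R -> R) (x l : R) : is_derive f x l ->
  forall e, 0 < e -> exists d, 0 < d /\
    forall y, Rabs (y - x) < d -> Rabs (f y - f x - (y - x) * l) <= e * Rabs (y - x).
Proof.
  intros [_ H] e He.
  destruct (H x (fun P HP => HP) (mkposreal e He)) as [d Hd].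
  exists d; split; [apply cond_pos|].
  intros y Hy; exact (Hd y Hy).
Qed.

Lemma cexp_near_0 (e : R) : 0 < e -> exists d, 0 < d /\ forall w, Cmod w < d ->
  Cmod (Cminus (Cminus (cexp w) (RtoC 1)) w) <= e * Cmod w.
Proof.
  intros He.
  (* The error terms [P1] to [P5] below add up to [7 * k * m]. The bound [k <= 1] also yields
     [|1 + x| <= 2] and [|sin y| <= 2 * |y|]. *)
  set (k := Rmin 1 (e / 7)).
  assert (Hk : 0 < k) by (apply Rmin_pos; lra).
  assert (Hk1 : k <= 1) by apply Rmin_l.
  assert (Hk2 : k <= e / 7) by apply Rmin_r.
  destruct (is_derive_eps exp 0 1) with (e := k) as [d1 [Hd1 He1]]; trivial.
  { replace 1 with (exp 0) by apply exp_0; apply is_derive_exp. }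
  destruct (is_derive_eps cos 0 0) with (e := k) as [d2 [Hd2 He2]]; trivial.
  { replace 0 with (- sin 0) at 2 by (rewrite sin_0; ring); apply is_derive_cos. }
  destruct (is_derive_eps sin 0 1) with (e := k) as [d3 [Hd3 He3]]; trivial.
  { replace 1 with (cos 0) by apply cos_0; apply is_derive_sin. }
  exists (Rmin k (Rmin d1 (Rmin d2 d3))); split; [repeat apply Rmin_pos; lra|].
  intros [x y] Hw.
  assert (M1 := Rmin_l k (Rmin d1 (Rmin d2 d3))); assert (M2 := Rmin_r k (Rmin d1 (Rmin d2 d3))).
  assert (M3 := Rmin_l d1 (Rmin d2 d3)); assert (M4 := Rmin_r d1 (Rmin d2 d3)).
  assert (M5 := Rmin_l d2 d3); assert (M6 := Rmin_r d2 d3).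
  assert (Hm := Rmax_Cmod (x, y)); simpl in Hm.
  assert (Hx := Rmax_l (Rabs x) (Rabs y)); assert (Hy := Rmax_r (Rabs x) (Rabs y)).
  set (m := Cmod (x, y)) in *.
  specialize (He1 x); specialize (He2 y); specialize (He3 y).
  rewrite !Rminus_0_r in He1, He2, He3.
  rewrite exp_0 in He1; rewrite cos_0 in He2; rewrite sin_0 in He3.
  specialize (He1 ltac:(lra)); specialize (He2 ltac:(lra)); specialize (He3 ltac:(lra)).
  rewrite Rmult_1_r in He1, He3; rewrite Rmult_0_r, Rminus_0_r in He2.
  rewrite Rminus_0_r in He3.
  assert (Hc := COS_bound y).
  assert (Hax := Rabs_pos x); assert (Hay := Rabs_pos y).
  eapply Rle_trans; [apply Cmod_le_abs|].
  unfold cexp, Cminus, Cplus, Copp, RtoC; simpl fst; simpl snd.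
  replace (exp x * cos y + - (1) + - x)
    with ((exp x - 1 - x) * cos y + (1 + x) * (cos y - 1)) by ring.
  replace (exp x * sin y + - 0 + - y)
    with ((exp x - 1 - x) * sin y + x * sin y + (sin y - y)) by ring.
  assert (Hs := SIN_bound y).
  assert (Bc : Rabs (cos y) <= 1) by (apply Rabs_le; lra).
  assert (Bs : Rabs (sin y) <= 1) by (apply Rabs_le; lra).
  assert (Bs2 : Rabs (sin y) <= 2 * Rabs y).
  { replace (sin y) with ((sin y - y) + y) by ring.
    eapply Rle_trans; [apply Rabs_triang|]; nra. }
  assert (B1x : Rabs (1 + x) <= 2).
  { eapply Rle_trans; [apply Rabs_triang|]; rewrite Rabs_R1; lra. }
  assert (P1 : Rabs ((exp x - 1 - x) * cos y) <= k * m).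
  { rewrite Rabs_mult.
    assert (Hq := Rabs_pos (exp x - 1 - x)); assert (Hq2 := Rabs_pos (cos y)).
    apply Rle_trans with (k * Rabs x); nra. }
  assert (P2 : Rabs ((1 + x) * (cos y - 1)) <= 2 * (k * m)).
  { rewrite Rabs_mult.
    apply Rle_trans with (2 * (k * Rabs y)); [|nra].
    apply Rmult_le_compat; auto using Rabs_pos. }
  assert (P3 : Rabs ((exp x - 1 - x) * sin y) <= k * m).
  { rewrite Rabs_mult.
    assert (Hq := Rabs_pos (exp x - 1 - x)); assert (Hq2 := Rabs_pos (sin y)).
    apply Rle_trans with (k * Rabs x); nra. }
  assert (P4 : Rabs (x * sin y) <= 2 * (k * m)).
  { rewrite Rabs_mult.
    apply Rle_trans with (k * (2 * Rabs y)); [|nra].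
    apply Rmult_le_compat; auto using Rabs_pos; lra. }
  assert (P5 : Rabs (sin y - y) <= k * m) by nra.
  assert (T1 := Rabs_triang ((exp x - 1 - x) * cos y) ((1 + x) * (cos y - 1))).
  assert (T2 := Rabs_triang ((exp x - 1 - x) * sin y + x * sin y) (sin y - y)).
  assert (T3 := Rabs_triang ((exp x - 1 - x) * sin y) (x * sin y)).
  assert (0 <= m) by apply Cmod_ge_0.
  apply Rle_trans with (7 * k * m); nra.
Qed.

Lemma cdiff_cexp (z : C) : cdiff cexp z (cexp z).
Proof.
  intros e He.
  assert (Hp : 0 < Cmod (cexp z)) by (rewrite Cmod_cexp; apply exp_pos).
  destruct (cexp_near_0 (e / Cmod (cexp z))) as [d [Hd Hw]];
    [apply Rdiv_lt_0_compat; lra|].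
  exists d; split; trivial; intros w Hwz.
  replace (cexp w) with (Cmult (cexp z) (cexp (Cminus w z))).
  2: { rewrite <- cexp_plus; f_equal; ring. }
  replace (Cminus (Cminus (Cmult (cexp z) (cexp (Cminus w z))) (cexp z))
            (Cmult (cexp z) (Cminus w z)))
    with (Cmult (cexp z) (Cminus (Cminus (cexp (Cminus w z)) (RtoC 1)) (Cminus w z)))
    by ring.
  rewrite Cmod_mult.
  specialize (Hw _ Hwz).
  apply (Rmult_le_compat_l (Cmod (cexp z))) in Hw; [|lra].
  eapply Rle_trans; [exact Hw|]; right; field; lra.
Qed.

(** * Cauchy's estimate for the first derivative *)

(* [w |-> (h (a + e^w) - h a) e^(-w)] is [2 i pi]-periodic, so its integral over
   a vertical period does not depend on [Re w] by Goursat's theorem, and it tends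
   to the derivative of [h] at [a] as [Re w] tends to minus infinity. *)
Theorem cauchy_estimate (h : C -> C) (a l : C) (r M : R) : 0 < r ->
  (forall z, Cmod (Cminus z a) <= r -> exists k, cdiff h z k) ->
  (forall z, Cmod (Cminus z a) <= r -> Cmod (h z) <= M) ->
  cdiff h a l -> Cmod l <= 2 * M / r.
Proof.
  intros Hr Hh HM Hl.
  (* The neutral factor 1 and summand 0 put the inner maps into the shape required by
     [cdiff_affine]. *)
  set (H := fun w : C => Cmult (Cminus (h (Cplus a (Cmult (RtoC 1) (cexp w)))) (h a))
                          (cexp (Cplus (RtoC 0) (Cmult (Copp (RtoC 1)) w)))).
  assert (Hin : forall w, fst w <= ln r ->
            Cmod (Cminus (Cplus a (Cmult (RtoC 1) (cexp w))) a) <= r).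
  { intros w Hw.
    replace (Cminus (Cplus a (Cmult (RtoC 1) (cexp w))) a) with (cexp w) by ring.
    rewrite Cmod_cexp, <- (exp_ln r Hr).
    destruct Hw as [Hw|Hw]; [left; apply exp_increasing, Hw|right; f_equal; exact Hw]. }
  assert (Hd : forall w, fst w <= ln r -> exists k, cdiff H w k).
  { intros w Hw.
    destruct (Hh _ (Hin w Hw)) as [k Hk].
    eexists; unfold H; apply cdiff_mult.
    - apply cdiff_minus; [|apply cdiff_const].
      apply (cdiff_comp (fun z => h (Cplus a (Cmult (RtoC 1) z))) cexp);
        [|apply cdiff_cexp].
      apply (cdiff_comp h (fun z => Cplus a (Cmult (RtoC 1) z))); [exact Hk|].
      apply cdiff_affine.
    - apply (cdiff_comp cexp (fun w => Cplus (RtoC 0) (Cmult (Copp (RtoC 1)) w))).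
      + apply cdiff_cexp.
      + apply cdiff_affine. }
  assert (Hmod : forall w, Cmod (cexp (Cplus (RtoC 0) (Cmult (Copp (RtoC 1)) w))) = / exp (fst w)).
  { intros w; rewrite Cmod_cexp, <- exp_Ropp; f_equal; simpl; ring. }
  (* The factor 2 is the price of subtracting [h a], which makes [H] a difference quotient. *)
  assert (Hbound : forall y, Cmod (H (ln r, y)) <= 2 * M / r).
  { intros y; unfold H; rewrite Cmod_mult, Hmod; simpl fst; rewrite exp_ln by trivial.
    apply Rmult_le_compat_r; [left; apply Rinv_0_lt_compat, Hr|].
    unfold Cminus; eapply Rle_trans; [apply Cmod_triangle|]; rewrite Cmod_opp.
    assert (H1 : Cmod (h (Cplus a (Cmult (RtoC 1) (cexp (ln r, y))))) <= M)
      by (apply HM, Hin; simpl; lra).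
    assert (H2 : Cmod (h a) <= M).
    { apply HM; replace (Cminus a a) with (RtoC 0) by ring; rewrite Cmod_0; lra. }
    lra. }
  apply le_epsilon; intros e He.
  destruct (Hl e He) as [d [Hd0 Hdl]].
  (* With this left side, [a + e^w] runs on a circle of radius less than [d] around [a], where the
     difference quotient is within [e] of [l]. *)
  set (s0 := Rmin (ln r) (ln (d / 2))).
  assert (Hs0 : s0 <= ln r) by apply Rmin_l.
  assert (Hs0d : exp s0 < d).
  { assert (Hs : s0 <= ln (d / 2)) by apply Rmin_r.
    assert (exp s0 <= exp (ln (d / 2))).
    { destruct Hs as [Hs|Hs]; [left; apply exp_increasing, Hs|right; f_equal; exact Hs]. }
    rewrite exp_ln in H0; lra. }
  assert (Hsmall : forall y, Cmod (Cminus (H (s0, y)) l) <= e).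
  { intros y; unfold H.
    set (k := cexp (s0, y)).
    set (k' := cexp (Cplus (RtoC 0) (Cmult (Copp (RtoC 1)) (s0, y)))).
    assert (Ek : Cmult k k' = RtoC 1).
    { unfold k, k'; generalize ((s0, y) : C); intros w.
      replace (Cplus 0 (Cmult (Copp 1) w)) with (Copp w) by ring.
      apply cexp_opp_mult. }
    replace (Cplus a (Cmult (RtoC 1) k)) with (Cplus a k) by ring.
    replace (Cminus (Cmult (Cminus (h (Cplus a k)) (h a)) k') l)
      with (Cmult (Cminus (Cminus (h (Cplus a k)) (h a)) (Cmult l (Cminus (Cplus a k) a))) k').
    2: { transitivity (Cminus (Cmult (Cminus (h (Cplus a k)) (h a)) k') (Cmult l (Cmult k k')));
           [ring | rewrite Ek; ring]. }
    rewrite Cmod_mult; unfold k' at 1; rewrite Hmod; simpl fst.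
    assert (Ekm : Cmod (Cminus (Cplus a k) a) = exp s0).
    { replace (Cminus (Cplus a k) a) with k by ring; apply Cmod_cexp. }
    specialize (Hdl (Cplus a k)); rewrite Ekm in Hdl; specialize (Hdl Hs0d).
    assert (Hp := exp_pos s0).
    apply (Rmult_le_compat_r (/ exp s0)) in Hdl; [|left; apply Rinv_0_lt_compat, Hp].
    rewrite Rmult_assoc, Rinv_r, Rmult_1_r in Hdl by lra; exact Hdl. }
  assert (Hpi := PI_RGT_0).
  assert (Hrect : forall z, rect s0 (ln r) 0 (2 * PI) z -> exists k, cdiff H z k)
    by (intros z [Hz _]; apply Hd; lra).
  assert (G := goursat H s0 (ln r) 0 (2 * PI) Hs0 ltac:(lra) Hrect).
  assert (Eper : int_h H s0 (ln r) (2 * PI) = int_h H s0 (ln r) 0).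
  { unfold int_h; apply (RInt_ext (V := C_R_CompleteNormedModule)); intros x _; unfold H.
    assert (E1 : cexp (x, 2 * PI) = cexp (x, 0))
      by (unfold cexp; simpl; rewrite cos_2PI, sin_2PI, cos_0, sin_0; reflexivity).
    assert (E2 : cexp (Cplus (RtoC 0) (Cmult (Copp (RtoC 1)) (x, 2 * PI))) =
                 cexp (Cplus (RtoC 0) (Cmult (Copp (RtoC 1)) (x, 0)))).
    { unfold cexp, Cplus, Cmult, Copp, RtoC; simpl.
      replace (0 + (- (1) * (2 * PI) + - 0 * x)) with (- (2 * PI)) by ring.
      replace (0 + (- (1) * 0 + - 0 * x)) with 0 by ring.
      replace (0 + (- (1) * x - - 0 * (2 * PI))) with (- x) by ring.
      replace (0 + (- (1) * x - - 0 * 0)) with (- x) by ring.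
      rewrite cos_neg, sin_neg, cos_2PI, sin_2PI, cos_0, sin_0; f_equal; ring. }
    rewrite E1, E2; reflexivity. }
  assert (Ev : int_v H (ln r) 0 (2 * PI) = int_v H s0 0 (2 * PI)).
  { unfold contour in G; rewrite Eper in G.
    replace (Cminus _ _) with
      (Cmult Ci (Cminus (int_v H (ln r) 0 (2 * PI)) (int_v H s0 0 (2 * PI)))) in G by ring.
    assert (E := f_equal (Cmult (Copp Ci)) G).
    replace (Cmult (Copp Ci) (Cmult Ci (Cminus (int_v H (ln r) 0 (2 * PI)) (int_v H s0 0 (2 * PI)))))
      with (Cmult (Copp (Cmult Ci Ci)) (Cminus (int_v H (ln r) 0 (2 * PI)) (int_v H s0 0 (2 * PI))))
      in E by ring.
    replace (Copp (Cmult Ci Ci)) with (RtoC 1) in E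
      by (unfold Copp, Cmult, Ci, RtoC; simpl; f_equal; ring).
    replace (int_v H (ln r) 0 (2 * PI)) with
      (Cplus (int_v H s0 0 (2 * PI)) (Cmult (RtoC 1) (Cminus (int_v H (ln r) 0 (2 * PI)) (int_v H s0 0 (2 * PI)))))
      by ring.
    rewrite E; ring. }
  assert (I1 : Cmod (int_v H (ln r) 0 (2 * PI)) <= (2 * PI - 0) * (2 * M / r)).
  { apply (Cmod_CRInt_le (fun y => H (ln r, y))); [lra|intros; apply Hbound|].
    apply (RInt_correct (V := C_R_CompleteNormedModule)).
    apply (ex_int_v H s0 (ln r) 0 (2 * PI) Hrect); lra. }
  assert (I2 : Cmod (Cminus (int_v H s0 0 (2 * PI)) (Cmult (RtoC (2 * PI - 0)) l)) <= (2 * PI - 0) * e).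
  { apply (Cmod_CRInt_le (fun y => Cminus (H (s0, y)) l)); [lra|intros; apply Hsmall|].
    apply (is_RInt_minus (V := C_R_NormedModule)).
    - apply (RInt_correct (V := C_R_CompleteNormedModule)).
      apply (ex_int_v H s0 (ln r) 0 (2 * PI) Hrect); lra.
    - replace (Cmult (RtoC (2 * PI - 0)) l) with (scal (V := C_R_NormedModule) (2 * PI - 0) l).
      + apply (is_RInt_const (V := C_R_NormedModule)).
      + destruct l; unfold scal, Cmult, RtoC; simpl; unfold prod_scal, scal; simpl.
        unfold mult; simpl; f_equal; ring. }
  rewrite Rminus_0_r in I1, I2; rewrite Ev in I1.
  assert (I3 : Cmod (Cmult (RtoC (2 * PI)) l) <= 2 * PI * (2 * M / r + e)).
  { replace (Cmult (RtoC (2 * PI)) l) with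
      (Cplus (int_v H s0 0 (2 * PI)) (Copp (Cminus (int_v H s0 0 (2 * PI)) (Cmult (RtoC (2 * PI)) l))))
      by ring.
    eapply Rle_trans; [apply Cmod_triangle|]; rewrite Cmod_opp; lra. }
  rewrite Cmod_mult, Cmod_R, Rabs_pos_eq in I3 by lra.
  apply Rmult_le_reg_l in I3; lra.
Qed.

(** * Mean value inequality and continuity of the derivative *)

Lemma seg_in_ball (a z w : C) (r t : R) : 0 <= t <= 1 ->
  Cmod (Cminus z a) <= r -> Cmod (Cminus w a) <= r ->
  Cmod (Cminus (seg z w t) a) <= r.
Proof.
  intros Ht Hz Hw; unfold seg.
  replace (Cminus (Cplus (Cmult (RtoC (1 - t)) z) (Cmult (RtoC t) w)) a)
    with (Cplus (Cmult (RtoC (1 - t)) (Cminus z a)) (Cmult (RtoC t) (Cminus w a)))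
    by (rewrite RtoC_minus; ring).
  eapply Rle_trans; [apply Cmod_triangle|].
  rewrite !Cmod_mult, !Cmod_R, !Rabs_pos_eq by lra; nra.
Qed.

Lemma seg_minus (z w : C) (s t : R) :
  Cminus (seg z w s) (seg z w t) = Cmult (RtoC (s - t)) (Cminus w z).
Proof. unfold seg; rewrite !RtoC_minus; ring. Qed.

(** The mean value theorem needs a real function; the free multiplier [c] selects the direction in
    which the values of [u] are projected. *)
Lemma cdiff_seg (u : C -> C) (z w c l : C) (t : R) : cdiff u (seg z w t) l ->
  is_derive (fun t => Re (Cmult c (u (seg z w t)))) t
    (Re (Cmult c (Cmult l (Cminus w z)))).
Proof.
  intros Hl.
  set (K := Cmod c * Cmod (Cminus w z) + 1).
  assert (HK : 0 < K).
  { assert (H1 := Rmult_le_pos _ _ (Cmod_ge_0 c) (Cmod_ge_0 (Cminus w z))); unfold K; lra. }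
  split; [apply is_linear_scal_l|].
  intros x Hx e.
  assert (E0 : t = x) by exact (is_filter_lim_locally_unique (V := R_NormedModule) t x Hx).
  subst x.
  destruct (Hl (e / K)) as [d [Hd Hdl]]; [apply Rdiv_lt_0_compat; [apply cond_pos|lra]|].
  assert (Hd' : 0 < d / (Cmod (Cminus w z) + 1)).
  { apply Rdiv_lt_0_compat; trivial; assert (H1 := Cmod_ge_0 (Cminus w z)); lra. }
  exists (mkposreal _ Hd'); intros s Hs.
  assert (Es := seg_minus z w s t).
  assert (Ms : Cmod (Cminus (seg z w s) (seg z w t)) = Rabs (s - t) * Cmod (Cminus w z))
    by (rewrite Es, Cmod_mult, Cmod_R; reflexivity).
  assert (Hp := Cmod_ge_0 (Cminus w z)).
  specialize (Hdl (seg z w s)); rewrite Ms in Hdl.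
  assert (Hlt : Rabs (s - t) * Cmod (Cminus w z) < d).
  { change (Rabs (s - t) < d / (Cmod (Cminus w z) + 1)) in Hs.
    apply (Rmult_lt_compat_r (Cmod (Cminus w z) + 1)) in Hs; [|lra].
    unfold Rdiv in Hs; rewrite Rmult_assoc, Rinv_l, Rmult_1_r in Hs by lra.
    assert (Hq := Rabs_pos (s - t)); nra. }
  specialize (Hdl Hlt).
  change (Rabs (Re (Cmult c (u (seg z w s))) - Re (Cmult c (u (seg z w t)))
    - (s - t) * Re (Cmult c (Cmult l (Cminus w z)))) <= e * Rabs (s - t)).
  replace (Re (Cmult c (u (seg z w s))) - Re (Cmult c (u (seg z w t)))
    - (s - t) * Re (Cmult c (Cmult l (Cminus w z))))
    with (Re (Cmult c (Cminus (Cminus (u (seg z w s)) (u (seg z w t)))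
            (Cmult l (Cminus (seg z w s) (seg z w t)))))).
  2: { rewrite Es; generalize (u (seg z w s)) (u (seg z w t)) (Cminus w z).
       intros [] [] []; destruct c, l; unfold Re, Cmult, Cminus, Cplus, Copp, RtoC; simpl; ring. }
  eapply Rle_trans; [apply re_le_Cmod|].
  rewrite Cmod_mult.
  apply (Rmult_le_compat_l (Cmod c)) in Hdl; [|apply Cmod_ge_0].
  eapply Rle_trans; [exact Hdl|].
  replace (Cmod c * (e / K * (Rabs (s - t) * Cmod (Cminus w z))))
    with ((e * Rabs (s - t)) * ((Cmod c * Cmod (Cminus w z)) / K)) by (field; lra).
  rewrite <- (Rmult_1_r (e * Rabs (s - t))) at 2.
  apply Rmult_le_compat_l.
  - apply Rmult_le_pos; [left; apply cond_pos|apply Rabs_pos].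
  - apply (Rmult_le_reg_r K); trivial.
    unfold Rdiv; rewrite Rmult_assoc, Rinv_l by lra; unfold K; lra.
Qed.

(** Projecting on the conjugate of the increment [k] turns the real increment into [|k| ^ 2], which
    the mean value theorem bounds by [|k|] times the right-hand side; it remains to cancel [|k|]. *)
Lemma mean_value_inequality (u D : C -> C) (z w : C) (M : R) :
  (forall t, 0 <= t <= 1 ->
     cdiff u (seg z w t) (D (seg z w t)) /\ Cmod (D (seg z w t)) <= M) ->
  Cmod (Cminus (u w) (u z)) <= M * Cmod (Cminus w z).
Proof.
  intros Hu.
  set (k := Cminus (u w) (u z)).
  destruct (MVT_gen (fun t => Re (Cmult (Cconj k) (u (seg z w t)))) 0 1
    (fun t => Re (Cmult (Cconj k) (Cmult (D (seg z w t)) (Cminus w z))))) as [c [Hc E]].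
  - intros x Hx; rewrite Rmin_left, Rmax_right in Hx by lra.
    apply cdiff_seg, Hu; lra.
  - intros x Hx; rewrite Rmin_left, Rmax_right in Hx by lra.
    apply continuity_pt_filterlim.
    apply (ex_derive_continuous (K := R_AbsRing) (V := R_NormedModule)).
    eexists; apply cdiff_seg, Hu; lra.
  - rewrite Rmin_left, Rmax_right in Hc by lra.
    destruct (Hu c Hc) as [_ HM].
    replace (seg z w 1) with w in E
      by (unfold seg; rewrite Rminus_diag; ring).
    replace (seg z w 0) with z in E
      by (unfold seg; rewrite Rminus_0_r; ring).
    replace (Re (Cmult (Cconj k) (u w)) - Re (Cmult (Cconj k) (u z)))
      with (Cmod k ^ 2) in E.
    2: { rewrite Cmod2_alt; unfold k; destruct (u w), (u z);
         unfold Cconj, Re, Im, Cmult, Cminus, Cplus, Copp; simpl; ring. }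
    assert (Hle : Cmod k ^ 2 <= Cmod k * (M * Cmod (Cminus w z))).
    { rewrite E, Rminus_0_r, Rmult_1_r.
      eapply Rle_trans; [apply Rle_abs|].
      eapply Rle_trans; [apply re_le_Cmod|].
      rewrite !Cmod_mult, Cmod_conj.
      apply Rmult_le_compat_l; [apply Cmod_ge_0|].
      apply Rmult_le_compat_r; [apply Cmod_ge_0|exact HM]. }
    destruct (Cmod_ge_0 k) as [Hk|Hk].
    + apply (Rmult_le_reg_l (Cmod k)); [exact Hk|lra].
    + rewrite <- Hk. apply Rmult_le_pos; [|apply Cmod_ge_0].
      eapply Rle_trans; [apply Cmod_ge_0|exact HM].
Qed.

(** Cauchy's estimate serves twice. Applied to [h] it gives a Lipschitz constant [L], so the
    difference [h (z + v) - h z] is bounded by [L * |v|]; applied to this difference it bounds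
    [D (a + v) - D a] by a multiple of [|v|]. *)
Lemma derivative_continuous (h D : C -> C) (a : C) (r : R) : 0 < r ->
  (forall z, Cmod (Cminus z a) < r -> cdiff h z (D z)) ->
  forall e, 0 < e -> exists d, 0 < d /\ forall w, Cmod (Cminus w a) < d ->
    Cmod (Cminus (D w) (D a)) < e.
Proof.
  intros Hr Hh e He.
  assert (Ca : Cmod (Cminus a a) = 0)
    by (replace (Cminus a a) with (RtoC 0) by ring; apply Cmod_0).
  destruct (cdiff_continuous h a (D a)) with (e := 1) as [d0 [Hd0 Hc]];
    [apply Hh; lra|lra|].
  set (M := Cmod (h a) + 1).
  assert (HM : forall z, Cmod (Cminus z a) < d0 -> Cmod (h z) <= M).
  { intros z Hz; specialize (Hc z Hz).
    replace (h z) with (Cplus (h a) (Cminus (h z) (h a))) by ring.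
    eapply Rle_trans; [apply Cmod_triangle|]; unfold M; lra. }
  assert (HM0 : 0 < M) by (assert (H1 := Cmod_ge_0 (h a)); unfold M; lra).
  (* One [s] for the ball of the second estimate, one for the shift by [v], one for the ball of the
     first estimate, and one to keep the inclusion strict. *)
  set (s := Rmin d0 r / 4).
  assert (Hs : 0 < s) by (assert (0 < Rmin d0 r) by (apply Rmin_pos; lra); unfold s; lra).
  assert (Hs1 : 4 * s <= d0) by (assert (H1 := Rmin_l d0 r); unfold s; lra).
  assert (Hs2 : 4 * s <= r) by (assert (H1 := Rmin_r d0 r); unfold s; lra).
  assert (Htri : forall z w x, Cmod (Cminus z x) <= Cmod (Cminus z w) + Cmod (Cminus w x)).
  { intros z w x; replace (Cminus z x) with (Cplus (Cminus z w) (Cminus w x)) by ring.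
    apply Cmod_triangle. }
  set (L := 2 * M / s).
  assert (HL : forall z, Cmod (Cminus z a) <= 2 * s -> Cmod (D z) <= L).
  { intros z Hz; apply (cauchy_estimate h z); trivial.
    - intros x Hx; exists (D x); apply Hh; specialize (Htri x z a); lra.
    - intros x Hx; apply HM; specialize (Htri x z a); lra.
    - apply Hh; lra. }
  assert (HLpos : 0 < L) by (unfold L; apply Rdiv_lt_0_compat; lra).
  assert (Hlip : forall z w, Cmod (Cminus z a) <= 2 * s -> Cmod (Cminus w a) <= 2 * s ->
             Cmod (Cminus (h w) (h z)) <= L * Cmod (Cminus w z)).
  { intros z w Hz Hw; apply (mean_value_inequality h D).
    intros t Ht; assert (Hb := seg_in_ball a z w (2 * s) t Ht Hz Hw).
    split; [apply Hh; lra|apply HL, Hb]. }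
  assert (He' : 0 < e * s / (4 * L)) by (apply Rdiv_lt_0_compat; nra).
  exists (Rmin s (e * s / (4 * L))); split; [apply Rmin_pos; lra|].
  intros w Hw.
  set (v := Cminus w a) in *.
  assert (Hv1 : Cmod v < s) by (eapply Rlt_le_trans; [exact Hw|apply Rmin_l]).
  assert (Hv2 : Cmod v < e * s / (4 * L)) by (eapply Rlt_le_trans; [exact Hw|apply Rmin_r]).
  assert (Hshift : forall z, Cmod (Cminus z a) <= s ->
     cdiff (fun z => Cminus (h (Cplus v (Cmult (RtoC 1) z))) (h z)) z
       (Cminus (Cmult (RtoC 1) (D (Cplus v (Cmult (RtoC 1) z)))) (D z)) /\
     Cmod (Cminus (h (Cplus v (Cmult (RtoC 1) z))) (h z)) <= L * Cmod v).
  { intros z Hz.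
    assert (Hzv : Cmod (Cminus (Cplus v (Cmult (RtoC 1) z)) a) <= 2 * s).
    { replace (Cminus (Cplus v (Cmult (RtoC 1) z)) a) with (Cplus v (Cminus z a)) by ring.
      eapply Rle_trans; [apply Cmod_triangle|]; lra. }
    split.
    - apply cdiff_minus; [|apply Hh; lra].
      apply (cdiff_comp h (fun z => Cplus v (Cmult (RtoC 1) z))).
      + apply Hh; lra.
      + apply cdiff_affine.
    - eapply Rle_trans; [apply Hlip; lra|].
      replace (Cminus (Cplus v (Cmult (RtoC 1) z)) z) with v by ring; lra. }
  assert (Hest : Cmod (Cminus (Cmult (RtoC 1) (D (Cplus v (Cmult (RtoC 1) a)))) (D a))
                   <= 2 * (L * Cmod v) / s).
  { apply (cauchy_estimate (fun z => Cminus (h (Cplus v (Cmult (RtoC 1) z))) (h z)) a); trivial.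
    - intros z Hz; eexists; apply Hshift, Hz.
    - intros z Hz; apply Hshift, Hz.
    - apply Hshift; lra. }
  replace (Cplus v (Cmult (RtoC 1) a)) with w in Hest by (unfold v; ring).
  replace (Cmult (RtoC 1) (D w)) with (D w) in Hest by ring.
  eapply Rle_lt_trans; [exact Hest|].
  apply (Rmult_lt_compat_l (2 * L / s)) in Hv2; [|apply Rdiv_lt_0_compat; lra].
  replace (2 * L / s * (e * s / (4 * L))) with (e / 2) in Hv2 by (field; lra).
  replace (2 * (L * Cmod v) / s) with (2 * L / s * Cmod v) by (field; lra).
  lra.
Qed.

(** * The factor [(d - 1) / Log d] *)

(** This is [buff_factor] as a function of the derivative alone, convertible to it, with the
    removable singularity isolated at [d = 1]. *)
Definition log_factor (d : C) : C :=
  if Ceq_dec d (RtoC 1) then RtoC 1 else Cdiv (Cminus d (RtoC 1)) (CLog d).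

(** The derivative of [atan x - x] is [- x ^ 2 / (1 + x ^ 2)], at most [s ^ 2] in modulus between 0
    and [s]. *)
Lemma atan_cubic (s : R) : Rabs (atan s - s) <= Rabs s * s ^ 2.
Proof.
  destruct (MVT_gen (fun x => atan x - x) 0 s (fun x => / (1 + x²) - 1)) as [c [Hc E]].
  - intros x _. apply (is_derive_minus atan (fun x => x) x); [apply is_derive_atan|apply (is_derive_id (K := R_AbsRing))].
  - intros x _. apply continuity_pt_filterlim.
    apply (ex_derive_continuous (K := R_AbsRing) (V := R_NormedModule) (fun x => atan x - x)).
    exists (/ (1 + x²) - 1).
    apply (is_derive_minus atan (fun x => x) x); [apply is_derive_atan|apply (is_derive_id (K := R_AbsRing))].
  - rewrite atan_0, !Rminus_0_r in E; rewrite E, Rabs_mult, Rmult_comm.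
    apply Rmult_le_compat_l; [apply Rabs_pos|].
    assert (Hcs : c² <= s ^ 2).
    { unfold Rsqr; destruct (Rle_dec 0 s).
      - rewrite Rmin_left, Rmax_right in Hc by lra; nra.
      - rewrite Rmin_right, Rmax_left in Hc by lra; nra. }
    assert (H0 := Rle_0_sqr c).
    assert (Hi : / (1 + c²) <= 1) by (rewrite <- Rinv_1; apply Rinv_le_contravar; lra).
    assert (Hi2 : 1 - c² <= / (1 + c²)).
    { apply (Rmult_le_reg_r (1 + c²)); [lra|]; rewrite Rinv_l by lra; nra. }
    apply Rabs_le; lra.
Qed.

(** In the real part, [ln rho] differs from [rho - 1], and [rho] from [Re d], only to second order.
    In the imaginary part the half-angle denominator [rho + p] is 2 up to [2 * m]. The constant 6 is
    2 for the real part plus 4 for the imaginary part. *)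
Lemma CLog_near_1 (d : C) : Cmod (Cminus d (RtoC 1)) <= 1 / 2 ->
  Cmod (Cminus (CLog d) (Cminus d (RtoC 1))) <= 6 * Cmod (Cminus d (RtoC 1)) ^ 2.
Proof.
  intros Hm.
  set (m := Cmod (Cminus d (RtoC 1))) in *.
  destruct d as [p y]; set (x := p - 1).
  assert (Hp : p = 1 + x) by (unfold x; ring).
  assert (Hxy := Rmax_Cmod (Cminus (p, y) (RtoC 1))); fold m in Hxy; simpl in Hxy.
  replace (p + - (1)) with x in Hxy by (unfold x; ring).
  replace (y + - 0) with y in Hxy by ring.
  assert (Hx := Rle_trans _ _ _ (Rmax_l _ _) Hxy).
  assert (Hy := Rle_trans _ _ _ (Rmax_r _ _) Hxy).
  assert (Hx' := proj1 (Rabs_le_between _ _) Hx); assert (Hy' := proj1 (Rabs_le_between _ _) Hy).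
  set (rho := Cmod (p, y)).
  assert (Hr2 : rho ^ 2 = (1 + x) ^ 2 + y ^ 2) by (unfold rho; rewrite Cmod2_alt, Hp; reflexivity).
  assert (Hr0 : 0 <= rho) by apply Cmod_ge_0.
  assert (Hy2 : y ^ 2 <= m ^ 2) by (assert (0 <= m) by (eapply Rle_trans; [apply Rabs_pos|exact Hx]); nra).
  assert (Hr3 : 1 + x <= rho) by nra.
  (* [y ^ 2] is the product of [rho - (1 + x)] and [rho + (1 + x)], and the second factor is at
     least 1. *)
  assert (Hr4 : rho - (1 + x) <= m ^ 2) by nra.
  assert (Hr5 : Rabs (rho - 1) <= m).
  { apply Rabs_le; split; [lra|].
    assert (T : forall w : C, Cmod w <= Cmod (Cminus w (RtoC 1)) + 1).
    { intros w; replace w with (Cplus (Cminus w (RtoC 1)) (RtoC 1)) at 1 by ring.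
      eapply Rle_trans; [apply Cmod_triangle|]; rewrite Cmod_1; lra. }
    specialize (T (p, y)); fold rho m in T; lra. }
  assert (Hr5' := proj1 (Rabs_le_between _ _) Hr5).
  assert (L1 : ln rho <= rho - 1).
  { assert (E := exp_ineq1_le (ln rho)); rewrite exp_ln in E; lra. }
  assert (L2 : (rho - 1) - 2 * m ^ 2 <= ln rho).
  { assert (E := exp_ineq1_le (- ln rho)).
    rewrite exp_Ropp, exp_ln in E by lra.
    (* With [t = rho - 1], multiplying the right-hand side by [1 + t] gives
       [1 + t ^ 2 * (1 + 2 * t)], and [t >= -1/2]. *)
    assert (E2 : / rho <= 1 - (rho - 1) + 2 * (rho - 1) ^ 2).
    { assert (P : 0 <= (rho - 1) ^ 2 * (1 + 2 * (rho - 1)))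
        by (apply Rmult_le_pos; [apply pow2_ge_0|lra]).
      apply (Rmult_le_reg_r rho); [lra|]; rewrite Rinv_l by lra; lra. }
    assert ((rho - 1) ^ 2 <= m ^ 2) by nra. lra. }
  set (q := rho + p).
  assert (Hq : 1 <= q) by (unfold q; lra).
  set (s := y / q).
  assert (Hsq : s * q = y) by (unfold s; field; lra).
  assert (Hs : Rabs s <= m).
  { unfold s, Rdiv; rewrite Rabs_mult, Rabs_inv, (Rabs_pos_eq q) by lra.
    assert (Hi : / q <= 1) by (rewrite <- Rinv_1; apply Rinv_le_contravar; lra).
    assert (0 < / q) by (apply Rinv_0_lt_compat; lra).
    assert (H1 := Rabs_pos y); nra. }
  assert (Hm0 : 0 <= m) by (eapply Rle_trans; [apply Rabs_pos|exact Hx]).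
  assert (A1 : Rabs (atan s - s) <= m ^ 2).
  { eapply Rle_trans; [apply atan_cubic|].
    assert (H1 := Rabs_pos s).
    assert (s ^ 2 <= m ^ 2).
    { rewrite <- (pow2_abs s); nra. }
    assert (0 <= s ^ 2) by nra.
    nra. }
  assert (A2 : Rabs (2 * s - y) <= 2 * m ^ 2).
  { replace (2 * s - y) with (s * (2 - q)) by (rewrite <- Hsq; ring).
    rewrite Rabs_mult.
    assert (H1 : Rabs (2 - q) <= 2 * m) by (apply Rabs_le; unfold q; lra).
    assert (H2 := Rabs_pos s); assert (H3 := Rabs_pos (2 - q)); nra. }
  eapply Rle_trans; [apply Cmod_le_abs|].
  unfold CLog; fold rho; unfold Cminus, Cplus, Copp, RtoC, Re, Im; simpl fst; simpl snd.
  fold q; fold s.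
  assert (B1 : Rabs (ln rho + - (p + - (1))) <= 2 * m ^ 2) by (apply Rabs_le; nra).
  assert (B2 : Rabs (2 * atan s + - (y + - 0)) <= 4 * m ^ 2).
  { replace (2 * atan s + - (y + - 0)) with (2 * (atan s - s) + (2 * s - y)) by ring.
    eapply Rle_trans; [apply Rabs_triang|].
    rewrite Rabs_mult, (Rabs_pos_eq 2) by lra; lra. }
  lra.
Qed.

(** * Continuity of curves in the plane *)

Lemma continuous_RC_eps_inv (f : R -> C) (x : R) :
  continuous (U := C_UniformSpace) f x ->
  forall e, 0 < e -> exists d, 0 < d /\
     forall y, Rabs (y - x) < d -> Cmod (Cminus (f y) (f x)) < e.
Proof.
  intros H e He.
  (* Balls of [C_UniformSpace] are squares; passing to the modulus costs a factor [sqrt 2]. *)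
  assert (Hs : 0 < sqrt 2) by (apply sqrt_lt_R0; lra).
  assert (He' : 0 < e / sqrt 2) by (apply Rdiv_lt_0_compat; lra).
  destruct (H (ball (f x) (mkposreal _ He'))) as [d Hd];
    [exists (mkposreal _ He'); intros y Hy; exact Hy|].
  exists d; split; [apply cond_pos|]; intros y Hy.
  specialize (Hd y Hy).
  apply C_NormedModule_mixin_compat2 in Hd; simpl in Hd.
  replace (sqrt 2 * (e / sqrt 2)) with e in Hd by (field; lra).
  exact Hd.
Qed.

Lemma continuous_RC_pair (f : R -> C) (x : R) :
  continuous (fun t => fst (f t)) x -> continuous (fun t => snd (f t)) x ->
  continuous (U := C_UniformSpace) f x.
Proof.
  intros H1 H2 P [e He].
  destruct (H1 _ (locally_ball (fst (f x)) e)) as [d1 Hd1].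
  destruct (H2 _ (locally_ball (snd (f x)) e)) as [d2 Hd2].
  exists (mkposreal _ (Rmin_pos _ _ (cond_pos d1) (cond_pos d2))).
  intros y Hy; apply He; split.
  - apply Hd1; eapply Rlt_le_trans; [exact Hy|apply Rmin_l].
  - apply Hd2; eapply Rlt_le_trans; [exact Hy|apply Rmin_r].
Qed.

Lemma continuous_RC_fst (f : R -> C) (x : R) :
  continuous (U := C_UniformSpace) f x -> continuous (fun t => fst (f t)) x.
Proof.
  intros H P [e He].
  destruct (H _ (locally_ball (f x) e)) as [d Hd].
  exists d; intros y Hy; apply He, (Hd y Hy).
Qed.

Lemma continuous_RC_snd (f : R -> C) (x : R) :
  continuous (U := C_UniformSpace) f x -> continuous (fun t => snd (f t)) x.
Proof.
  intros H P [e He].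
  destruct (H _ (locally_ball (f x) e)) as [d Hd].
  exists d; intros y Hy; apply He, (Hd y Hy).
Qed.

Lemma continuous_RC_mult (f g : R -> C) (x : R) :
  continuous (U := C_UniformSpace) f x -> continuous (U := C_UniformSpace) g x ->
  continuous (U := C_UniformSpace) (fun t => Cmult (f t) (g t)) x.
Proof.
  intros Hf Hg.
  assert (F1 := continuous_RC_fst _ _ Hf); assert (F2 := continuous_RC_snd _ _ Hf).
  assert (G1 := continuous_RC_fst _ _ Hg); assert (G2 := continuous_RC_snd _ _ Hg).
  apply continuous_RC_pair; simpl.
  - apply (continuous_minus (fun t => fst (f t) * fst (g t)) (fun t => snd (f t) * snd (g t)));
      apply (continuous_mult (K := R_AbsRing)); assumption.
  - apply (continuous_plus (fun t => fst (f t) * snd (g t)) (fun t => snd (f t) * fst (g t)));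
      apply (continuous_mult (K := R_AbsRing)); assumption.
Qed.

Lemma continuous_RC_normsq (f : R -> C) (x : R) :
  continuous (U := C_UniformSpace) f x ->
  continuous (fun t => fst (f t) ^ 2 + snd (f t) ^ 2) x.
Proof.
  intros Hf.
  assert (F1 := continuous_RC_fst _ _ Hf); assert (F2 := continuous_RC_snd _ _ Hf).
  apply continuous_ext with (f := fun t => fst (f t) * fst (f t) + snd (f t) * snd (f t)).
  - intros t; unfold pow; rewrite !Rmult_1_r; reflexivity.
  - apply (continuous_plus (fun t => fst (f t) * fst (f t)) (fun t => snd (f t) * snd (f t)));
      apply (continuous_mult (K := R_AbsRing)); assumption.
Qed.

Lemma continuous_RC_inv (f : R -> C) (x : R) :
  continuous (U := C_UniformSpace) f x -> f x <> RtoC 0 ->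
  continuous (U := C_UniformSpace) (fun t => Cinv (f t)) x.
Proof.
  intros Hf Hnz.
  assert (F1 := continuous_RC_fst _ _ Hf); assert (F2 := continuous_RC_snd _ _ Hf).
  assert (Hn : continuous (fun t => / (fst (f t) ^ 2 + snd (f t) ^ 2)) x).
  { apply (continuous_Rinv_comp (fun t => fst (f t) ^ 2 + snd (f t) ^ 2)).
    - apply continuous_RC_normsq, Hf.
    - apply Cmod_gt_0 in Hnz.
      assert (E := Cmod2_alt (f x)); unfold Re, Im in E.
      rewrite <- E; apply pow_nonzero; lra. }
  apply continuous_RC_pair; simpl.
  - apply (continuous_mult (K := R_AbsRing)); assumption.
  - apply (continuous_mult (K := R_AbsRing) (fun t => - snd (f t))); trivial.
    apply (continuous_opp (fun t => snd (f t))); assumption.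
Qed.

Lemma continuous_RC_CLog (f : R -> C) (x : R) :
  continuous (U := C_UniformSpace) f x -> 0 < Re (f x) ->
  continuous (U := C_UniformSpace) (fun t => CLog (f t)) x.
Proof.
  intros Hf Hre.
  assert (F1 := continuous_RC_fst _ _ Hf); assert (F2 := continuous_RC_snd _ _ Hf).
  assert (Hc : continuous (fun t => Cmod (f t)) x)
    by (apply continuous_sqrt_comp, continuous_RC_normsq, Hf).
  assert (Hpos : 0 < Cmod (f x)).
  { apply Cmod_gt_0; intros E; rewrite E in Hre; simpl in Hre; lra. }
  apply continuous_RC_pair; simpl.
  - apply (continuous_comp (fun t => Cmod (f t)) ln); trivial.
    apply continuous_ln, Hpos.
  - apply (continuous_mult (K := R_AbsRing) (fun _ => 2)); [apply continuous_const|].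
    apply continuous_atan_comp.
    apply (continuous_mult (K := R_AbsRing) (fun t => Im (f t))); trivial.
    apply (continuous_Rinv_comp (fun t => Cmod (f t) + Re (f t))).
    + apply (continuous_plus (fun t => Cmod (f t))); trivial.
    + lra.
Qed.

(** * Size and continuity of the factor near [d = 1] *)

Lemma Re_near_1 (d : C) (m : R) : Cmod (Cminus d (RtoC 1)) <= m -> 1 - m <= Re d.
Proof.
  intros Hm.
  assert (H := Rle_trans _ _ _ (re_le_Cmod _) Hm).
  apply Rabs_le_between in H; unfold Re in *; simpl in H; lra.
Qed.

(** Below the threshold [1 / 12] the quadratic error [6 * m ^ 2] is at most [m / 2]. *)
Lemma CLog_lower (d : C) : Cmod (Cminus d (RtoC 1)) <= 1 / 12 ->
  Cmod (Cminus d (RtoC 1)) / 2 <= Cmod (CLog d).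
Proof.
  intros Hd.
  assert (H := CLog_near_1 d ltac:(lra)).
  set (m := Cmod (Cminus d (RtoC 1))) in *.
  assert (T : m <= Cmod (CLog d) + Cmod (Cminus (CLog d) (Cminus d (RtoC 1)))).
  { unfold m; replace (Cminus d (RtoC 1)) with
      (Cplus (CLog d) (Copp (Cminus (CLog d) (Cminus d (RtoC 1))))) at 1 by ring.
    eapply Rle_trans; [apply Cmod_triangle|]; rewrite Cmod_opp; lra. }
  assert (0 <= m) by apply Cmod_ge_0.
  nra.
Qed.

Lemma CLog_neq_0 (d : C) : Cmod (Cminus d (RtoC 1)) <= 1 / 12 -> d <> RtoC 1 ->
  CLog d <> RtoC 0.
Proof.
  intros Hd Hne E.
  assert (H := CLog_lower d Hd); rewrite E, Cmod_0 in H.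
  assert (Hp : 0 < Cmod (Cminus d (RtoC 1))); [|lra].
  apply Cmod_gt_0; intros E2; apply Hne.
  replace d with (Cplus (Cminus d (RtoC 1)) (RtoC 1)) by ring; rewrite E2; ring.
Qed.

(** The constant is the quadratic error [6 * m ^ 2] divided by the lower bound [m / 2] for the
    logarithm. *)
Lemma log_factor_near_1 (d : C) : Cmod (Cminus d (RtoC 1)) <= 1 / 12 ->
  Cmod (Cminus (log_factor d) (RtoC 1)) <= 12 * Cmod (Cminus d (RtoC 1)).
Proof.
  intros Hd; unfold log_factor.
  assert (Hm := Cmod_ge_0 (Cminus d (RtoC 1))).
  destruct (Ceq_dec d (RtoC 1)) as [E|Hne].
  - replace (Cminus (RtoC 1) (RtoC 1)) with (RtoC 0) by ring; rewrite Cmod_0; lra.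
  - assert (Hnz := CLog_neq_0 d Hd Hne).
    assert (Hp : 0 < Cmod (CLog d)) by (apply Cmod_gt_0, Hnz).
    assert (Hlow := CLog_lower d Hd).
    assert (Hest := CLog_near_1 d ltac:(lra)).
    replace (Cminus (Cdiv (Cminus d (RtoC 1)) (CLog d)) (RtoC 1))
      with (Cdiv (Copp (Cminus (CLog d) (Cminus d (RtoC 1)))) (CLog d)) by (field; exact Hnz).
    rewrite Cmod_div, Cmod_opp by exact Hnz.
    apply (Rmult_le_reg_r (Cmod (CLog d))); trivial.
    unfold Rdiv; rewrite Rmult_assoc, Rinv_l, Rmult_1_r by lra.
    eapply Rle_trans; [exact Hest|]; nra.
Qed.

(** Where [f x = 1], continuity comes from the linear bound of [log_factor_near_1]; elsewhere the
    factor coincides near [x] with a quotient of continuous functions. *)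
Lemma continuous_RC_log_factor (f : R -> C) (x : R) :
  continuous (U := C_UniformSpace) f x -> Cmod (Cminus (f x) (RtoC 1)) <= 1 / 24 ->
  continuous (U := C_UniformSpace) (fun t => log_factor (f t)) x.
Proof.
  intros Hf Hx.
  destruct (Ceq_dec (f x) (RtoC 1)) as [E|Hne].
  - apply continuous_RC_eps; intros e He.
    destruct (continuous_RC_eps_inv f x Hf (Rmin (1 / 12) (e / 12))) as [d [Hd Hy]];
      [apply Rmin_pos; lra|].
    exists d; split; trivial; intros y Hyd; specialize (Hy y Hyd).
    assert (M1 := Rmin_l (1 / 12) (e / 12)); assert (M2 := Rmin_r (1 / 12) (e / 12)).
    rewrite E in Hy |- *.
    replace (log_factor (RtoC 1)) with (RtoC 1)
      by (unfold log_factor; destruct (Ceq_dec 1 1); [reflexivity|contradiction]).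
    eapply Rle_lt_trans; [apply log_factor_near_1; lra|]; lra.
  - assert (Hre : 0 < Re (f x)).
    { assert (H1 := Re_near_1 _ _ Hx); lra. }
    apply continuous_ext_loc with
      (g := fun t => Cmult (Cplus (f t) (Copp (RtoC 1))) (Cinv (CLog (f t)))).
    + destruct (continuous_RC_eps_inv f x Hf (Cmod (Cminus (f x) (RtoC 1)))) as [d [Hd Hy]].
      { apply Cmod_gt_0; intros E; apply Hne.
        replace (f x) with (Cplus (Cminus (f x) (RtoC 1)) (RtoC 1)) by ring; rewrite E; ring. }
      exists (mkposreal d Hd); intros y Hyd; specialize (Hy y Hyd).
      unfold log_factor; destruct (Ceq_dec (f y) (RtoC 1)) as [E|]; [|reflexivity].
      exfalso; rewrite E, <- Cmod_opp in Hy.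
      replace (Copp (Cminus (RtoC 1) (f x))) with (Cminus (f x) (RtoC 1)) in Hy by ring.
      lra.
    + apply continuous_RC_mult.
      * apply (continuous_plus (K := R_AbsRing) (V := C_R_NormedModule) f (fun _ => Copp (RtoC 1))); trivial.
        apply continuous_const.
      * apply continuous_RC_inv; [apply continuous_RC_CLog; assumption|].
        apply CLog_neq_0; [lra|exact Hne].
Qed.

(** * Lifting segments *)

Lemma cdiff_C_derive (h : C -> C) (z : C) : holo_at h z -> cdiff h z (C_derive h z).
Proof.
  intros H; apply cdiff_is_derive, C_derive_correct; [exact z | exact H].
Qed.

Lemma seg_in_disk (z w : C) (r t : R) : 0 <= t <= 1 ->
  Cmod z < r -> Cmod w < r -> Cmod (seg z w t) < r.
Proof.
  intros Ht Hz Hw.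
  assert (E0 : forall v : C, Cminus v (RtoC 0) = v) by (intros; ring).
  assert (H := seg_in_ball (RtoC 0) z w (Rmax (Cmod z) (Cmod w)) t Ht).
  rewrite !E0 in H.
  eapply Rle_lt_trans; [apply H; [apply Rmax_l|apply Rmax_r]|].
  apply Rmax_lub_lt; assumption.
Qed.

Lemma continuous_seg_comp (h : C -> C) (z w : C) (t : R) :
  (forall e, 0 < e -> exists d, 0 < d /\ forall v, Cmod (Cminus v (seg z w t)) < d ->
     Cmod (Cminus (h v) (h (seg z w t))) < e) ->
  continuous (U := C_UniformSpace) (fun s => h (seg z w s)) t.
Proof.
  intros H; apply continuous_RC_eps; intros e He.
  destruct (H e He) as [d [Hd Hv]].
  assert (Hp := Cmod_ge_0 (Cminus w z)).
  exists (d / (Cmod (Cminus w z) + 1)); split; [apply Rdiv_lt_0_compat; lra|].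
  intros s Hs; apply Hv.
  rewrite seg_minus, Cmod_mult, Cmod_R.
  apply (Rmult_lt_compat_r (Cmod (Cminus w z) + 1)) in Hs; [|lra].
  unfold Rdiv in Hs; rewrite Rmult_assoc, Rinv_l, Rmult_1_r in Hs by lra.
  assert (Hq := Rabs_pos (s - t)); nra.
Qed.

(* With [c = 1] this is the forward segment, with [c = -1] the backward one. *)
Lemma lift_segment_near (h : C -> C) (r eps : R) (z w k : C) (c : R) :
  0 < eps < 1 ->
  (forall v, Cmod v < r -> holo_at h v /\
     Cmod (Cminus (C_derive h v) (RtoC 1)) <= eps / 52) ->
  Cmod z < r -> Cmod w < r -> k <> RtoC 0 -> Rabs c = 1 ->
  Cminus w z = Cmult (RtoC c) k ->
  (forall t, 0 <= t <= 1 ->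
     Cmod (Cminus (Cminus (h (seg z w t)) (seg z w t)) k) <= eps / 52 * Cmod k) ->
  exists Z : R -> C, lift_segment h z w Z /\
    forall t, 0 < t <= 1 ->
      Cmod (Cminus (Z t) (Cplus (Z 0) (Cmult (RtoC c) (RtoC t)))) < eps * t.
Proof.
  intros Heps Hh Hz Hw Hk Hc Hwz Hu.
  assert (Hkp : 0 < Cmod k) by (apply Cmod_gt_0, Hk).
  set (F := fun s => Cmult (buff_coef h (seg z w s)) (Cminus w z)).
  assert (Hseg : forall t, 0 <= t <= 1 -> Cmod (seg z w t) < r)
    by (intros; apply seg_in_disk; assumption).
  assert (Hlow : forall t, 0 <= t <= 1 ->
    Cmod k / 2 <= Cmod (Cminus (h (seg z w t)) (seg z w t))).
  { intros t Ht; specialize (Hu t Ht).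
    set (u := Cminus (h (seg z w t)) (seg z w t)) in *.
    assert (T : Cmod k <= Cmod u + Cmod (Cminus u k)).
    { replace k with (Cplus u (Copp (Cminus u k))) at 1 by ring.
      eapply Rle_trans; [apply Cmod_triangle|]; rewrite Cmod_opp; lra. }
    nra. }
  assert (Hnz : forall t, 0 <= t <= 1 -> Cminus (h (seg z w t)) (seg z w t) <> RtoC 0).
  { intros t Ht E; specialize (Hlow t Ht); rewrite E, Cmod_0 in Hlow; lra. }
  assert (Hcont : forall t, 0 <= t <= 1 -> continuous (U := C_UniformSpace) F t).
  { intros t Ht; unfold F, buff_coef.
    assert (Hpos : 0 < r - Cmod (seg z w t)) by (specialize (Hseg t Ht); lra).
    assert (Hnear : forall v, Cmod (Cminus v (seg z w t)) < r - Cmod (seg z w t) -> Cmod v < r).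
    { intros v Hv; replace v with (Cplus (seg z w t) (Cminus v (seg z w t))) by ring.
      eapply Rle_lt_trans; [apply Cmod_triangle|]; lra. }
    apply continuous_RC_mult; [|apply continuous_const].
    apply continuous_RC_mult.
    - apply (continuous_RC_log_factor (fun s => C_derive h (seg z w s))).
      + apply continuous_seg_comp.
        apply (derivative_continuous h (C_derive h) _ _ Hpos).
        intros v Hv; apply cdiff_C_derive, Hh, Hnear, Hv.
      + eapply Rle_trans; [apply Hh, Hseg, Ht|]; lra.
    - apply continuous_RC_inv; [|apply Hnz, Ht].
      apply (continuous_seg_comp (fun v => Cminus (h v) v)).
      apply (cdiff_continuous (fun v => Cminus (h v) v) _ (Cminus (C_derive h (seg z w t)) (RtoC 1))).
      apply (cdiff_minus h (fun v => v)).
      + apply cdiff_C_derive, Hh, Hseg, Ht.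
      + apply cdiff_ext_loc with (f := fun v => Cplus (RtoC 0) (Cmult (RtoC 1) v)) (r := 1);
          [lra | intros; ring | apply cdiff_affine]. }
  (* Origin of 52: as [|k / u| <= 2], the logarithmic factor contributes [24 * (eps / 52)] and the
     variation of the displacement [2 * (eps / 52)], together [eps / 2]. The other half of [eps]
     makes the final inequality strict. *)
  assert (HF : forall t, 0 <= t <= 1 -> Cmod (Cminus (F t) (RtoC c)) <= eps / 2).
  { intros t Ht; unfold F, buff_coef; rewrite Hwz.
    change (buff_factor h (seg z w t)) with (log_factor (C_derive h (seg z w t))).
    assert (Hd := proj2 (Hh _ (Hseg t Ht))).
    assert (Hlf := log_factor_near_1 (C_derive h (seg z w t)) ltac:(lra)).
    set (f := log_factor (C_derive h (seg z w t))) in *.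
    specialize (Hu t Ht); specialize (Hlow t Ht); specialize (Hnz t Ht).
    set (u := Cminus (h (seg z w t)) (seg z w t)) in *.
    replace (Cminus (Cmult (Cdiv f u) (Cmult (RtoC c) k)) (RtoC c))
      with (Cmult (RtoC c) (Cminus (Cmult (Cminus f (RtoC 1)) (Cdiv k u)) (Cdiv (Cminus u k) u)))
      by (field; exact Hnz).
    rewrite Cmod_mult, Cmod_R, Hc, Rmult_1_l.
    assert (Hup : 0 < Cmod u) by lra.
    assert (V1 : Cmod (Cdiv k u) <= 2).
    { rewrite Cmod_div by exact Hnz; apply (Rmult_le_reg_r (Cmod u)); trivial.
      unfold Rdiv; rewrite Rmult_assoc, Rinv_l by lra; lra. }
    assert (V2 : Cmod (Cdiv (Cminus u k) u) <= 2 * (eps / 52)).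
    { rewrite Cmod_div by exact Hnz; apply (Rmult_le_reg_r (Cmod u)); trivial.
      unfold Rdiv at 1; rewrite Rmult_assoc, Rinv_l by lra; nra. }
    unfold Cminus at 1; eapply Rle_trans; [apply Cmod_triangle|].
    rewrite Cmod_opp, Cmod_mult.
    assert (V3 : Cmod (Cminus f (RtoC 1)) * Cmod (Cdiv k u) <= (12 * (eps / 52)) * 2)
      by (apply Rmult_le_compat; try apply Cmod_ge_0; lra).
    lra. }
  (* A lift is determined up to an additive constant; this branch starts at 0. *)
  assert (HZ : exists Z : R -> C, Z 0 = RtoC 0 /\
    forall t, 0 <= t <= 1 -> is_RInt (V := C_R_NormedModule) F 0 t (Z t)).
  { exists (fun t => RInt (V := C_R_CompleteNormedModule) F 0 t); split.
    - apply (RInt_point (V := C_R_CompleteNormedModule)).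
    - intros t Ht; apply (RInt_correct (V := C_R_CompleteNormedModule)).
      apply ex_CRInt_continuous; [lra|]; intros s Hs; apply Hcont; lra. }
  destruct HZ as [Z [HZ0 Hint]].
  exists Z; split; [split|].
  - intros t Ht; split; [|split].
    + apply Hh, Hseg, Ht.
    + intros [_ Hcut].
      assert (Hd := proj2 (Hh _ (Hseg t Ht))).
      assert (H1 := Re_near_1 _ _ Hd); lra.
    + intros E; apply (Hnz t Ht); rewrite E; ring.
  - intros t Ht; rewrite HZ0.
    replace (Cminus (Z t) (RtoC 0)) with (Z t) by ring; apply Hint, Ht.
  - intros t Ht; rewrite HZ0.
    replace (Cminus (Z t) (Cplus (RtoC 0) (Cmult (RtoC c) (RtoC t))))
      with (Cminus (Z t) (Cmult (RtoC (t - 0)) (RtoC c)))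
      by (rewrite Rminus_0_r; ring).
    assert (Hb : Cmod (Cminus (Z t) (Cmult (RtoC (t - 0)) (RtoC c))) <= (t - 0) * (eps / 2)).
    { apply (Cmod_CRInt_le (fun s => Cminus (F s) (RtoC c))); [lra| |].
      - intros s Hs; apply HF; lra.
      - apply (is_RInt_minus (V := C_R_NormedModule)); [apply Hint; lra|].
        replace (Cmult (RtoC (t - 0)) (RtoC c)) with (scal (V := C_R_NormedModule) (t - 0) (RtoC c)).
        + apply (is_RInt_const (V := C_R_NormedModule)).
        + unfold scal, Cmult, RtoC; simpl; unfold prod_scal, scal; simpl.
          unfold mult; simpl; f_equal; ring. }
    nra.
Qed.

(** * Preimages *)

(** Compactness in gauge form: the same [d] is the size of a neighborhood and a lower bound for
    [|f|] on its part in the annulus, so a positive lower bound for the gauge is the required [m].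
    Around 0 and around centers of modulus at least [rho], the gauge is so small that the
    neighborhood misses the annulus. *)
Lemma annulus_lower_bound (f : C -> C) (r1 r0 rho : R) :
  0 < r1 -> r0 < rho ->
  (forall z, Cmod z < rho -> exists l, cdiff f z l) ->
  (forall z, Cmod z < rho -> z <> RtoC 0 -> f z <> RtoC 0) ->
  exists m, 0 < m /\ forall z, r1 <= Cmod z <= r0 -> m <= Cmod (f z).
Proof.
  intros Hr1 Hr0 Hf Hnz.
  assert (Hloc : forall t u : R, exists d : posreal, forall x y : R,
    Rabs (x - t) < d -> Rabs (y - u) < d -> r1 <= Cmod (x, y) <= r0 -> d <= Cmod (f (x, y))).
  { intros t u.
    assert (Hdist : forall x y d, Rabs (x - t) < d -> Rabs (y - u) < d ->
               Cmod (Cminus (x, y) (t, u)) < 2 * d).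
    { intros x y d Hx Hy; eapply Rle_lt_trans; [apply Cmod_le_abs|]; simpl.
      unfold Rminus in Hx, Hy; lra. }
    destruct (Ceq_dec (t, u) (RtoC 0)) as [E|Hne].
    - assert (Hd : 0 < r1 / 2) by lra.
      exists (mkposreal _ Hd); intros x y Hx Hy Hz; exfalso.
      specialize (Hdist x y (r1 / 2) Hx Hy); rewrite E in Hdist.
      replace (Cminus (x, y) (RtoC 0)) with ((x, y) : C) in Hdist
        by (unfold Cminus, Cplus, Copp, RtoC; simpl; f_equal; ring).
      lra.
    - destruct (Rle_dec rho (Cmod (t, u))) as [Hge|Hlt].
      + assert (Hd : 0 < (rho - r0) / 2) by lra.
        exists (mkposreal _ Hd); intros x y Hx Hy Hz; exfalso.
        specialize (Hdist x y _ Hx Hy); simpl in Hdist.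
        assert (T : forall p q : C, Cmod p <= Cmod q + Cmod (Cminus q p)).
        { intros p q; replace p with (Cplus q (Copp (Cminus q p))) at 1 by ring.
          eapply Rle_trans; [apply Cmod_triangle|]; rewrite Cmod_opp; lra. }
        specialize (T (t, u) (x, y)); lra.
      + apply Rnot_le_lt in Hlt.
        destruct (Hf _ Hlt) as [l Hl].
        assert (Hp : 0 < Cmod (f (t, u))) by (apply Cmod_gt_0, Hnz; assumption).
        destruct (cdiff_continuous _ _ _ Hl (Cmod (f (t, u)) / 2)) as [d [Hd Hc]]; [lra|].
        assert (Hm : 0 < Rmin (d / 2) (Cmod (f (t, u)) / 2)) by (apply Rmin_pos; lra).
        exists (mkposreal _ Hm); simpl; intros x y Hx Hy _.
        specialize (Hdist x y _ Hx Hy).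
        assert (M1 := Rmin_l (d / 2) (Cmod (f (t, u)) / 2)).
        assert (M2 := Rmin_r (d / 2) (Cmod (f (t, u)) / 2)).
        specialize (Hc (x, y) ltac:(lra)).
        assert (T : Cmod (f (t, u)) <= Cmod (f (x, y)) + Cmod (Cminus (f (x, y)) (f (t, u)))).
        { replace (f (t, u)) with (Cplus (f (x, y)) (Copp (Cminus (f (x, y)) (f (t, u))))) at 1 by ring.
          eapply Rle_trans; [apply Cmod_triangle|]; rewrite Cmod_opp; lra. }
        lra. }
  set (delta := fun t u => proj1_sig (constructive_indefinite_description _ (Hloc t u))).
  destruct (compactness_value_2d (- r0) r0 (- r0) r0 delta) as [d Hd].
  exists d; split; [apply cond_pos|].
  intros [x y] Hz.
  (* [compactness_value_2d] yields only a doubly negated existence, which suffices for a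
     refutation. *)
  destruct (Rle_dec d (Cmod (f (x, y)))) as [|Hn]; [assumption|exfalso].
  assert (Hm := Rmax_Cmod (x, y)); simpl in Hm.
  assert (Hx := Rle_trans _ _ _ (Rmax_l _ _) Hm).
  assert (Hy := Rle_trans _ _ _ (Rmax_r _ _) Hm).
  apply Rabs_le_between in Hx; apply Rabs_le_between in Hy.
  apply (Hd x y); [lra|lra|].
  intros [t [u [_ [_ [Htx [Huy Hdl]]]]]].
  apply Hn.
  assert (Hs := proj2_sig (constructive_indefinite_description _ (Hloc t u)) x y Htx Huy Hz).
  unfold delta in Hdl; eapply Rle_trans; [exact Hdl|exact Hs].
Qed.

(** The solution is the fixed point of [w |-> z - u w], a contraction of ratio [1 / 2] that
    preserves the ball of radius [r] because [|z| <= r / 2]. The iterates converge by comparing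
    their telescoping series with a geometric one. *)
Lemma near_identity_surjective (u : C -> C) (r : R) (z : C) :
  (forall v w, Cmod v <= r -> Cmod w <= r ->
     Cmod (Cminus (u w) (u v)) <= 1 / 2 * Cmod (Cminus w v)) ->
  u (RtoC 0) = RtoC 0 -> Cmod z <= r / 2 ->
  exists w, Cmod w <= r /\ Cplus w (u w) = z.
Proof.
  intros Hu Hu0 Hz.
  assert (Hz0 := Cmod_ge_0 z).
  assert (E0 : forall v : C, Cminus v (RtoC 0) = v) by (intros; ring).
  set (s := fix s (n : nat) : C := match n with O => RtoC 0 | S n => Cminus z (u (s n)) end).
  assert (Hin : forall n, Cmod (s n) <= r).
  { induction n as [|n IH]; [simpl; rewrite Cmod_0; lra|].
    assert (H := Hu (RtoC 0) (s n)); rewrite Cmod_0, Hu0, !E0 in H.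
    specialize (H ltac:(lra) IH).
    simpl; unfold Cminus; eapply Rle_trans; [apply Cmod_triangle|]; rewrite Cmod_opp; lra. }
  assert (Hstep : forall n, Cmod (Cminus (s (S n)) (s n)) <= Cmod z * (1 / 2) ^ n).
  { induction n as [|n IH].
    - simpl; rewrite Hu0, !E0; lra.
    - change (s (S (S n))) with (Cminus z (u (s (S n)))).
      replace (Cminus (Cminus z (u (s (S n)))) (s (S n)))
        with (Copp (Cminus (u (s (S n))) (u (s n)))) by (simpl; ring).
      rewrite Cmod_opp.
      eapply Rle_trans; [apply Hu; apply Hin|].
      change ((1 / 2) ^ S n) with (1 / 2 * (1 / 2) ^ n); lra. }
  destruct (ex_series_le (K := C_AbsRing) (V := C_CompleteNormedModule)
    (fun n => Cminus (s (S n)) (s n)) (fun n => Cmod z * (1 / 2) ^ n) Hstep) as [w Hw].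
  { apply (ex_series_scal_l (K := R_AbsRing) (Cmod z) (fun n => (1 / 2) ^ n)), ex_series_geom.
    rewrite Rabs_pos_eq; lra. }
  assert (Hsum : forall n, sum_n (G := C_AbelianMonoid) (fun n => Cminus (s (S n)) (s n)) n = s (S n)).
  { induction n as [|n IH].
    - rewrite sum_O; simpl; ring.
    - rewrite sum_Sn, IH.
      change (Cplus (s (S n)) (Cminus (s (S (S n))) (s (S n))) = s (S (S n))); ring. }
  assert (Hlim : forall e, 0 < e -> exists N, forall n, (N <= n)%nat -> Cmod (Cminus (s (S n)) w) < e).
  { intros e He.
    assert (Hs : 0 < sqrt 2) by (apply sqrt_lt_R0; lra).
    assert (He' : 0 < e / sqrt 2) by (apply Rdiv_lt_0_compat; lra).
    destruct (Hw _ (locally_ball (T := C_UniformSpace) w (mkposreal _ He'))) as [N HN].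
    exists N; intros n Hn; specialize (HN n Hn).
    assert (E := Hsum n).
    apply C_NormedModule_mixin_compat2 in HN; simpl in HN.
    replace (sqrt 2 * (e / sqrt 2)) with e in HN by (field; lra).
    rewrite <- E; exact HN. }
  assert (Hwr : Cmod w <= r).
  { apply le_epsilon; intros e He.
    destruct (Hlim e He) as [N HN]; specialize (HN N (le_n N)).
    replace w with (Cplus (s (S N)) (Copp (Cminus (s (S N)) w))) by ring.
    eapply Rle_trans; [apply Cmod_triangle|]; rewrite Cmod_opp; specialize (Hin (S N)); lra. }
  exists w; split; [exact Hwr|].
  assert (Hz' : Cmod (Cminus (Cplus w (u w)) z) = 0).
  { apply Rle_antisym; [|apply Cmod_ge_0].
    apply le_epsilon; intros e He; rewrite Rplus_0_l.
    destruct (Hlim (e / 2)) as [N HN]; [lra|].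
    assert (H1 := HN N (le_n N)); assert (H2 := HN (S N) (le_S _ _ (le_n N))).
    replace (Cminus (Cplus w (u w)) z) with
      (Copp (Cplus (Cminus (s (S (S N))) w) (Cminus (u (s (S N))) (u w)))) by (simpl; ring).
    rewrite Cmod_opp; eapply Rle_trans; [apply Cmod_triangle|].
    assert (H3 := Hu w (s (S N)) Hwr (Hin (S N))); lra. }
  apply Cmod_eq_0 in Hz'.
  replace (Cplus w (u w)) with (Cplus (Cminus (Cplus w (u w)) z) z) by ring.
  rewrite Hz'; ring.
Qed.

(** * Consequences of the expansions at the origin *)

Lemma fixes_0_of_expansion (g : C -> C) (l : C) (M d : R) : 0 < d ->
  (forall z : C, Cmod z < d -> Cmod (Cminus (g z) (Cmult l z)) <= M * Cmod z ^ 2) ->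
  g (RtoC 0) = RtoC 0.
Proof.
  intros Hd H.
  specialize (H (RtoC 0)); rewrite Cmod_0 in H; specialize (H Hd).
  replace (Cminus (g (RtoC 0)) (Cmult l (RtoC 0))) with (g (RtoC 0)) in H by ring.
  apply Cmod_eq_0, Rle_antisym; [|apply Cmod_ge_0].
  eapply Rle_trans; [exact H|]; right; ring.
Qed.

Lemma iterate_fixed (q : nat) (g : C -> C) (z : C) : g z = z -> iterate q g z = z.
Proof.
  intros H; unfold iterate; induction q as [|q IH]; simpl; [reflexivity|].
  rewrite IH; exact H.
Qed.

Lemma pow_le_sq (x : R) (n : nat) : 0 <= x <= 1 -> (2 <= n)%nat -> x ^ n <= x ^ 2.
Proof.
  intros Hx Hn; replace n with (2 + (n - 2))%nat by lia; rewrite pow_add.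
  assert (H : x ^ (n - 2) <= 1 ^ (n - 2)) by (apply pow_incr; lra).
  rewrite pow1 in H; assert (0 <= x ^ 2) by apply pow2_ge_0; nra.
Qed.

(** Since [q >= 1], all exponents beyond the linear term are at least 2. Order 2 is what Cauchy's
    estimate needs: dividing by the radius still leaves a small quantity. *)
Lemma displacement_quadratic (q : nat) (f : C -> C) (b : C) (M d : R) : (1 <= q)%nat ->
  (forall z : C, Cmod z < d ->
     Cmod (Cminus (f z) (Cplus (Cplus z (Cpow z (q + 1))) (Cmult b (Cpow z (2 * q + 1)))))
       <= M * Cmod z ^ (2 * q + 2)) ->
  forall z, Cmod z < d -> Cmod z <= 1 ->
    Cmod (Cminus (f z) z) <= (1 + Cmod b + Rabs M) * Cmod z ^ 2.
Proof.
  intros Hq H z Hz Hz1; specialize (H z Hz).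
  assert (Hz0 := Cmod_ge_0 z); assert (Hb := Cmod_ge_0 b).
  replace (Cminus (f z) z) with
    (Cplus (Cminus (f z) (Cplus (Cplus z (Cpow z (q + 1))) (Cmult b (Cpow z (2 * q + 1)))))
       (Cplus (Cpow z (q + 1)) (Cmult b (Cpow z (2 * q + 1))))) by ring.
  eapply Rle_trans; [apply Cmod_triangle|].
  assert (T := Cmod_triangle (Cpow z (q + 1)) (Cmult b (Cpow z (2 * q + 1)))).
  rewrite Cmod_mult, !Cmod_pow in T.
  assert (P1 := pow_le_sq (Cmod z) (q + 1) ltac:(lra) ltac:(lia)).
  assert (P2 := pow_le_sq (Cmod z) (2 * q + 1) ltac:(lra) ltac:(lia)).
  assert (P3 := pow_le_sq (Cmod z) (2 * q + 2) ltac:(lra) ltac:(lia)).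
  assert (P4 : M * Cmod z ^ (2 * q + 2) <= Rabs M * Cmod z ^ 2).
  { assert (H1 := Rle_abs M); assert (H2 := Rabs_pos M).
    assert (0 <= Cmod z ^ (2 * q + 2)) by (apply pow_le; lra). nra. }
  assert (P5 : Cmod b * Cmod z ^ (2 * q + 1) <= Cmod b * Cmod z ^ 2)
    by (apply Rmult_le_compat_l; lra).
  lra.
Qed.

(** The inverse branch enters through its values: a preimage in the disk of radius [r0] exists, and
    the estimate holds for each such preimage. The backward clause is thus neither vacuous nor
    dependent on a choice. *)
Theorem theoremA (q : nat) (lam : C) (g : C -> C) (b : C) (r0 : R)
  (lamn : nat -> C) (gn : nat -> C -> C) :
  (1 <= q)%nat ->
  primitive_root q lam ->
  (* g(z) = lam z + O(z^2), holomorphic near 0 *)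
  (exists d : R, 0 < d /\ holo_on g (disk d)) ->
  (exists M d : R, 0 < d /\ forall z : C, Cmod z < d ->
     Cmod (Cminus (g z) (Cmult lam z)) <= M * Cmod z ^ 2) ->
  (* f := g^q = z + z^(q+1) + b z^(2q+1) + O(z^(2q+2)) *)
  (exists M d : R, 0 < d /\ forall z : C, Cmod z < d ->
     Cmod (Cminus (iterate q g z)
             (Cplus (Cplus z (Cpow z (q + 1))) (Cmult b (Cpow z (2 * q + 1)))))
       <= M * Cmod z ^ (2 * q + 2)) ->
  0 < r0 < 1 ->
  (* f univalent in a neighborhood of the closed disk of radius r0 *)
  (exists rho : R, r0 < rho /\ holo_on (iterate q g) (disk rho)
                   /\ inj_on (iterate q g) (disk rho)) ->
  (forall z : C, Cmod z <= r0 -> iterate q g z = z -> z = RtoC 0) ->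
  (forall z : C, Cmod z <= r0 -> 0 < Re (C_derive (iterate q g) z)) ->
  (* g_n(z) = lam_n z + O(z^2) holomorphic, |lam_n| <> 1 *)
  (forall n : nat, exists d : R, 0 < d /\ holo_on (gn n) (disk d)) ->
  (forall n : nat, exists M d : R, 0 < d /\ forall z : C, Cmod z < d ->
     Cmod (Cminus (gn n z) (Cmult (lamn n) z)) <= M * Cmod z ^ 2) ->
  (forall n : nat, Cmod (lamn n) <> 1) ->
  (* f_n := g_n^q holomorphic in a neighborhood of the closed disk *)
  (forall n : nat, exists rho : R, r0 < rho /\ holo_on (iterate q (gn n)) (disk rho)) ->
  (* f_n -> f uniformly on the closed disk *)
  (forall e : R, 0 < e -> exists N : nat, forall n : nat, (N <= n)%nat ->
     forall z : C, Cmod z <= r0 ->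
       Cmod (Cminus (iterate q (gn n) z) (iterate q g z)) < e) ->
  forall eps : R, 0 < eps < 1 ->
  exists r : R, 0 < r < r0 /\
  exists N : nat, forall n : nat, (N <= n)%nat ->
  forall z : C, Cmod z < r -> iterate q (gn n) z <> z ->
    (exists Z : R -> C,
       lift_segment (iterate q (gn n)) z (iterate q (gn n) z) Z /\
       forall t : R, 0 < t <= 1 ->
         Cmod (Cminus (Z t) (Cplus (Z 0) (RtoC t))) < eps * t) /\
    (* f_n^{-1}(z): the preimage of z near 0 *)
    (exists w : C, Cmod w < r0 /\ iterate q (gn n) w = z) /\
    (forall w : C, Cmod w < r0 -> iterate q (gn n) w = z ->
     exists Zh : R -> C,
       lift_segment (iterate q (gn n)) z w Zh /\
       forall t : R, 0 < t <= 1 ->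
         Cmod (Cminus (Zh t) (Cminus (Zh 0) (RtoC t))) < eps * t).
Proof.
  intros Hq _ _ [Mg [dg [Hdg Hg]]] [M [d0 [Hd0 Hexp]]] Hr0 [rho [Hrho [Hholo Hinj]]]
    _ _ _ Hgn _ Hfn Hunif eps Heps.
  set (f := iterate q g) in *.
  assert (Hf0 : f (RtoC 0) = RtoC 0)
    by (apply iterate_fixed, (fixes_0_of_expansion _ _ _ _ Hdg Hg)).
  assert (Hdisp := displacement_quadratic q f b M d0 Hq Hexp).
  set (K := 1 + Cmod b + Rabs M) in *.
  assert (HK : 0 < K)
    by (assert (H1 := Cmod_ge_0 b); assert (H2 := Rabs_pos M); unfold K; lra).
  assert (HA : 0 < eps / (104 * (1 + 4 * K))) by (apply Rdiv_lt_0_compat; lra).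
  (* On the disk of radius [2 * r1], [u] is at most [r1 ^ 2] from [f_n - f] plus [K * (2 * r1) ^ 2]
     from [f - id]; the last condition is Cauchy's bound [2 * M / r] for this [u] and radius
     [r1]. *)
  assert (Hr1 : exists r1, 0 < r1 /\ 4 * r1 <= d0 /\ 4 * r1 <= r0 /\
    2 * (1 + 4 * K) * r1 <= eps / 52).
  { exists (Rmin (eps / (104 * (1 + 4 * K))) (Rmin d0 r0 / 4)).
    assert (M1 := Rmin_l (eps / (104 * (1 + 4 * K))) (Rmin d0 r0 / 4)).
    assert (M2 := Rmin_r (eps / (104 * (1 + 4 * K))) (Rmin d0 r0 / 4)).
    assert (M3 := Rmin_l d0 r0); assert (M4 := Rmin_r d0 r0).
    assert (M5 : 0 < Rmin d0 r0) by (apply Rmin_pos; lra).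
    repeat split; [apply Rmin_pos; lra|lra|lra|].
    apply (Rmult_le_compat_l (2 * (1 + 4 * K))) in M1; [|lra].
    eapply Rle_trans; [exact M1|]; right; field; lra. }
  destruct Hr1 as [r1 [Hr1 [Hr1d [Hr1r Hr1e]]]].
  destruct (annulus_lower_bound f r1 r0 rho Hr1 Hrho) as [m [Hm Hann]].
  { intros z Hz; eexists; apply cdiff_C_derive, Hholo, Hz. }
  (* Injectivity together with [f 0 = 0] excludes any other zero of [f]. *)
  { intros z Hz Hne E; apply Hne, Hinj; [exact Hz| |rewrite Hf0; exact E].
    unfold disk; rewrite Cmod_0; lra. }
  (* The bound [r1 / 4] keeps [f_n z] in the disk of radius [r1] and suits the contraction on radius
     [r1 / 2]. The bound [m / 2], with [f_n] within [m / 2] of [f], gives [|f w| < m] for every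
     preimage [w] of [z], which keeps [w] out of the annulus. *)
  set (r := Rmin (r1 / 4) (m / 2)).
  assert (Hr : 0 < r) by (apply Rmin_pos; lra).
  assert (Hrr1 : r <= r1 / 4) by apply Rmin_l.
  assert (Hrm : r <= m / 2) by apply Rmin_r.
  exists r; split; [lra|].
  destruct (Hunif (Rmin (r1 ^ 2) (m / 2))) as [N HN];
    [apply Rmin_pos; [apply pow_lt|]; lra|].
  exists N; intros n Hn z Hz Hzfix.
  specialize (HN n Hn); specialize (Hgn n); specialize (Hfn n).
  set (fn := iterate q (gn n)) in *.
  destruct Hgn as [Mn [dn [Hdn Hgn]]].
  assert (Hfn0 : fn (RtoC 0) = RtoC 0)
    by (apply iterate_fixed, (fixes_0_of_expansion _ _ _ _ Hdn Hgn)).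
  destruct Hfn as [rn [Hrn Hfn]].
  set (u := fun v => Cminus (fn v) v).
  set (D := fun v => Cminus (C_derive fn v) (RtoC 1)).
  assert (Hud : forall v, Cmod v <= r0 -> cdiff u v (D v)).
  { intros v Hv; apply (cdiff_minus fn (fun v => v)).
    - apply cdiff_C_derive, Hfn; unfold disk; lra.
    - apply cdiff_ext_loc with (f := fun v => Cplus (RtoC 0) (Cmult (RtoC 1) v)) (r := 1);
        [lra | intros; ring | apply cdiff_affine]. }
  assert (Hub : forall v, Cmod v <= 2 * r1 -> Cmod (u v) <= (1 + 4 * K) * r1 ^ 2).
  { intros v Hv; unfold u.
    replace (Cminus (fn v) v) with (Cplus (Cminus (fn v) (f v)) (Cminus (f v) v)) by ring.
    eapply Rle_trans; [apply Cmod_triangle|].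
    specialize (HN v ltac:(lra)); specialize (Hdisp v ltac:(lra) ltac:(lra)).
    assert (M1 := Rmin_l (r1 ^ 2) (m / 2)).
    assert (Cmod v ^ 2 <= (2 * r1) ^ 2)
      by (apply pow_incr; split; [apply Cmod_ge_0|exact Hv]).
    nra. }
  assert (HDb : forall v, Cmod v < r1 -> Cmod (D v) <= eps / 52).
  { intros v Hv.
    assert (Hin : forall x, Cmod (Cminus x v) <= r1 -> Cmod x <= 2 * r1).
    { intros x Hx; replace x with (Cplus (Cminus x v) v) by ring.
      eapply Rle_trans; [apply Cmod_triangle|]; lra. }
    eapply Rle_trans; [apply (cauchy_estimate u v (D v) r1 ((1 + 4 * K) * r1 ^ 2) Hr1)|].
    - intros x Hx; specialize (Hin x Hx); exists (D x); apply Hud; lra.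
    - intros x Hx; apply Hub, Hin, Hx.
    - apply Hud; lra.
    - eapply Rle_trans; [|exact Hr1e]; right; field; lra. }
  assert (Hlip : forall v w, Cmod v < r1 -> Cmod w < r1 ->
            Cmod (Cminus (u w) (u v)) <= eps / 52 * Cmod (Cminus w v)).
  { intros v w Hv Hw; apply (mean_value_inequality u D); intros t Ht.
    assert (Hs := seg_in_disk v w r1 t Ht Hv Hw).
    split; [apply Hud; lra|apply HDb, Hs]. }
  assert (Hu0 : u (RtoC 0) = RtoC 0) by (unfold u; rewrite Hfn0; ring).
  assert (Hgood : forall v, Cmod v < r1 -> holo_at fn v /\
            Cmod (Cminus (C_derive fn v) (RtoC 1)) <= eps / 52).
  { intros v Hv; split; [apply Hfn; unfold disk; lra|apply HDb, Hv]. }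
  assert (Hz1 : Cmod z < r1) by lra.
  split; [|split].
  - assert (Huz : Cmod (u z) <= Cmod z).
    { assert (H := Hlip (RtoC 0) z); rewrite Cmod_0, Hu0 in H.
      specialize (H Hr1 Hz1).
      replace (Cminus (u z) (RtoC 0)) with (u z) in H by ring.
      replace (Cminus z (RtoC 0)) with z in H by ring.
      assert (H2 := Cmod_ge_0 z); nra. }
    assert (Hfz : Cmod (fn z) < r1).
    { replace (fn z) with (Cplus z (u z)) by (unfold u; ring).
      eapply Rle_lt_trans; [apply Cmod_triangle|]; lra. }
    assert (Hk : u z <> RtoC 0).
    { intros E; apply Hzfix.
      replace (fn z) with (Cplus z (u z)) by (unfold u; ring); rewrite E; ring. }
    destruct (lift_segment_near fn r1 eps z (fn z) (u z) 1 Heps Hgood Hz1 Hfz Hk Rabs_R1)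
      as [Z [HZ HZb]].
    + unfold u; ring.
    + intros t Ht.
      eapply Rle_trans; [apply (Hlip z (seg z (fn z) t) Hz1 (seg_in_disk _ _ _ _ Ht Hz1 Hfz))|].
      replace (Cminus (seg z (fn z) t) z) with (Cmult (RtoC t) (u z))
        by (unfold u, seg; rewrite RtoC_minus; ring).
      rewrite Cmod_mult, Cmod_R, Rabs_pos_eq by lra.
      assert (H := Cmod_ge_0 (u z)); apply Rmult_le_compat_l; nra.
    + exists Z; split; [exact HZ|]; intros t Ht.
      replace (RtoC t) with (Cmult (RtoC 1) (RtoC t)) by ring; apply HZb, Ht.
  (* The contraction runs on a closed disk, while [Hlip] covers the open disk of radius [r1]; half
     the radius fits. *)
  - destruct (near_identity_surjective u (r1 / 2) z) as [w [Hw Ew]].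
    + intros v w Hv Hw; eapply Rle_trans; [apply Hlip; lra|].
      apply Rmult_le_compat_r; [apply Cmod_ge_0|lra].
    + exact Hu0.
    + lra.
    + exists w; split; [lra|]; rewrite <- Ew; unfold u; ring.
  - intros w Hw Ew.
    assert (Hw1 : Cmod w < r1).
    { destruct (Rlt_le_dec (Cmod w) r1) as [|Hge]; [assumption|exfalso].
      assert (H1 := Hann w ltac:(lra)); assert (H2 := HN w ltac:(lra)).
      assert (M1 := Rmin_r (r1 ^ 2) (m / 2)).
      rewrite Ew in H2.
      assert (T : Cmod (f w) <= Cmod z + Cmod (Cminus z (f w))).
      { replace (f w) with (Cplus z (Copp (Cminus z (f w)))) at 1 by ring.
        eapply Rle_trans; [apply Cmod_triangle|]; rewrite Cmod_opp; lra. }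
      lra. }
    assert (Hk : u w <> RtoC 0).
    { intros E; apply Hzfix.
      assert (Ewz : w = z).
      { rewrite <- Ew; replace (fn w) with (Cplus w (u w)) by (unfold u; ring).
        rewrite E; ring. }
      rewrite <- Ewz at 1; exact Ew. }
    (* The segment still starts at [z], but displacements are compared with the one at its end [w],
       from which its points have distance [(1 - t) * |u w|]. *)
    destruct (lift_segment_near fn r1 eps z w (u w) (-1) Heps Hgood Hz1 Hw1 Hk)
      as [Z [HZ HZb]].
    + rewrite Rabs_left; lra.
    + unfold u; rewrite Ew; ring.
    + intros t Ht.
      eapply Rle_trans; [apply (Hlip w (seg z w t) Hw1 (seg_in_disk _ _ _ _ Ht Hz1 Hw1))|].
      replace (Cminus (seg z w t) w) with (Cmult (RtoC (1 - t)) (u w))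
        by (unfold u, seg; rewrite Ew, RtoC_minus; ring).
      rewrite Cmod_mult, Cmod_R, Rabs_pos_eq by lra.
      assert (H := Cmod_ge_0 (u w)); apply Rmult_le_compat_l; nra.
    + exists Z; split; [exact HZ|]; intros t Ht.
      replace (Cminus (Z 0) (RtoC t)) with (Cplus (Z 0) (Cmult (RtoC (-1)) (RtoC t)))
        by ring.
      apply HZb, Ht.
Qed.
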